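(* Let $P\in\mathbb{C}(x)$ be a rational function with $m$ simple poles and $m$ simple zeroes, where $m>0$, such that the $2m$ corresponding points of $\mathbb{C}$ all lie on different orbits under the action of $\mathrm{SL}(2,\mathbb{Z})$ on $\mathbb{P}^1$ by $x\mapsto\frac{ax+b}{cx+d}$ and have no isotropy. Then the morphism $\theta_P\colon\mathrm{SL}(2,\mathbb{Z})\to\mathrm{Bir}(\mathbb{C}^2)=\mathrm{Bir}(\mathbb{P}^2)$ determined by $$\theta_P(S)=\left(-\frac1x,\ \mathbf{i}y\right),\qquad \theta_P(RS)=\left(\frac{x-1}{x},\ y\cdot\frac{P\left(\frac{x-1}{x}\right)}{P(x)}\right)$$ is a parabolic embedding.
   Context: $\mathbf{i}=\sqrt{-1}$. $\mathrm{Bir}(\mathbb{P}^2)$ is the group of birational self-maps of the complex projective plane; $(p(x,y),q(x,y))$ denotes the birational map $(x,y)\dashrightarrow(p(x,y),q(x,y))$ of $\mathbb{C}^2$. $R=\begin{bmatrix}1&1\\0&1\end{bmatrix}$ and $S=\begin{bmatrix}0&1\\-1&0\end{bmatrix}$ generate $\mathrm{SL}(2,\mathbb{Z})$, which has the presentation $\langle R,S\mid S^4=(RS)^3=1,\ S^2(RS)=(RS)S^2\rangle$; the formulas $\theta_P(S)=\left(-\frac1x,\ \mathbf{i}y\right)$ and $\theta_P(RS)=\left(\frac{x-1}{x},\ y\cdot\frac{P\left(\frac{x-1}{x}\right)}{P(x)}\right)$ define a unique homomorphism $\theta_P$. ''No isotropy'' means trivial stabiliser in $\mathrm{PSL}(2,\mathbb{Z})$.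 For $f\in\mathrm{Bir}(\mathbb{P}^2)$, $\deg f$ is the common degree of the homogeneous polynomials without common factor defining $f$; $f$ is parabolic if $(\deg f^n)_{n}$ grows linearly or quadratically. An embedding (injective homomorphism) $\theta\colon\mathrm{SL}(2,\mathbb{Z})\to\mathrm{Bir}(\mathbb{P}^2)$ is parabolic if each element of infinite order of its image is parabolic. *)

(* Defs.v *)
From HB Require Import structures.
From mathcomp Require Import all_boot all_order all_algebra.
From mathcomp Require Import reals complex mpoly.

Set Implicit Arguments.
Unset Strict Implicit.
Unset Printing Implicit Defensive.

Import GRing.Theory.
Local Open Scope ring_scope.
Local Open Scope quotient_scope.

Record SL2Z : Type := MkSL2Z {
  SL2Zval :> 'M[int]_2;
  SL2Z_det : \det SL2Zval == 1 }.

HB.instance Definition _ := [isSub for SL2Zval].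
HB.instance Definition _ := [Choice of SL2Z by <:].

Fact SL2Z_one_subproof : \det (1%:M : 'M[int]_2) == 1.
Proof. by rewrite det1. Qed.
Definition SL2Z_one : SL2Z := MkSL2Z SL2Z_one_subproof.

Fact SL2Z_mul_subproof (M N : SL2Z) : \det (M *m N) == 1.
Proof. by rewrite det_mulmx (eqP (SL2Z_det M)) (eqP (SL2Z_det N)). Qed.
Definition SL2Z_mul (M N : SL2Z) : SL2Z := MkSL2Z (SL2Z_mul_subproof M N).

Lemma SL2Z_unit (M : SL2Z) : (M : 'M[int]_2) \in unitmx.
Proof. by rewrite unitmxE (eqP (SL2Z_det M)) unitr1. Qed.

Fact SL2Z_inv_subproof (M : SL2Z) : \det (invmx M) == 1.
Proof. by rewrite det_inv (eqP (SL2Z_det M)) invr1. Qed.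
Definition SL2Z_inv (M : SL2Z) : SL2Z := MkSL2Z (SL2Z_inv_subproof M).

Fact SL2Z_mulA : associative SL2Z_mul.
Proof. by move=> M N Q; apply: val_inj; rewrite /= mulmxA. Qed.
Fact SL2Z_mul1 : left_id SL2Z_one SL2Z_mul.
Proof. by move=> M; apply: val_inj; rewrite /= mul1mx. Qed.
Fact SL2Z_mulr1 : right_id SL2Z_one SL2Z_mul.
Proof. by move=> M; apply: val_inj; rewrite /= mulmx1. Qed.
Fact SL2Z_mulV : left_inverse SL2Z_one SL2Z_inv SL2Z_mul.
Proof. by move=> M; apply: val_inj; rewrite /= mulVmx ?SL2Z_unit. Qed.
Fact SL2Z_mulrV : right_inverse SL2Z_one SL2Z_inv SL2Z_mul.
Proof. by move=> M; apply: val_inj; rewrite /= mulmxV ?SL2Z_unit. Qed.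

HB.instance Definition _ := isGroup.Build SL2Z
  SL2Z_mulA SL2Z_mul1 SL2Z_mulr1 SL2Z_mulV SL2Z_mulrV.

Definition mx22 (a b c d : int) : 'M[int]_2 :=
  \matrix_(i < 2, j < 2) nth 0 (nth [::] [:: [:: a; b]; [:: c; d]] i) j.

Fact matR_subproof : \det (mx22 1 1 0 1) == 1.
Proof. by rewrite (expand_det_row _ 0) !big_ord_recl big_ord0 /cofactor !det_mx11 !mxE. Qed.
Fact matS_subproof : \det (mx22 0 1 (-1) 0) == 1.
Proof. by rewrite (expand_det_row _ 0) !big_ord_recl big_ord0 /cofactor !det_mx11 !mxE. Qed.
Definition matR : SL2Z := MkSL2Z matR_subproof.
Definition matS : SL2Z := MkSL2Z matS_subproof.

Section ProjectiveLine.
Variable R : realType.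
Local Notation C := R[i].

(* P^1 is [option C], with [None] the point at infinity. *)
Definition mobius (M : SL2Z) (z : option C) : option C :=
  let a := (M 0 0)%:~R in let b := (M 0 1)%:~R in
  let c := (M 1 0)%:~R in let d := (M 1 1)%:~R in
  match z with
  | Some x => if c * x + d == 0 then None else Some ((a * x + b) / (c * x + d))
  | None => if c == 0 then None else Some (a / c)
  end.

Definition same_orbit (z w : option C) : Prop :=
  exists M : SL2Z, mobius M z = w.

(* The stabiliser of [z] in PSL(2,Z) = SL(2,Z)/{1,-1} is trivial. *)
Definition no_isotropy (z : option C) : Prop :=
  forall M : SL2Z, mobius M z = z ->
    (M : 'M[int]_2) = 1%:M \/ (M : 'M[int]_2) = - 1%:M.

End ProjectiveLine.

Section Order.
Variable R : realType.
Local Notation C := R[i].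
Implicit Types (P : {fraction {poly C}}) (a : C).

(* [P] has order [k] at [a]; the zero function has no order anywhere. *)
Definition has_order P a (k : int) : Prop :=
  exists n d : {poly C},
    [/\ n.[a] != 0, d.[a] != 0 &
        P = FracField.tofrac ('X - a%:P) ^ k *
            (FracField.tofrac n / FracField.tofrac d)].

Definition is_zero P a : Prop := exists2 k, 0 < k & has_order P a k.
Definition is_pole P a : Prop := exists2 k, k < 0 & has_order P a k.
Definition is_simple_zero P a : Prop := has_order P a 1.
Definition is_simple_pole P a : Prop := has_order P a (-1).

End Order.

Lemma frac_numden (A : idomainType) (r : {fraction A}) :
  r = FracField.tofrac \n_(repr r) / FracField.tofrac \d_(repr r).
Proof.
have dr0 : \d_(repr r) != 0 by exact: denom_ratioP.
have d0 : FracField.tofrac \d_(repr r) != 0 by rewrite tofrac_eq0.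
apply: (mulIf d0); rewrite divfK //.
set x := repr r in dr0 *; have -> : r = \pi_({fraction A}) x by rewrite reprK.
rewrite /FracField.tofrac; unlock.
have -> (u v : {fraction A}) : u * v = FracField.mul u v by [].
rewrite -FracField.pi_mul.
apply/eqmodP; rewrite /= FracField.equivfE /FracField.mulf.
have n1 (z : A) : \n_(Ratio z 1) = z by rewrite numer_Ratio ?oner_neq0.
have d1 (z : A) : \d_(Ratio z 1) = 1 by rewrite denom_Ratio ?oner_neq0.
by rewrite !(n1, d1) !mulr1 (numer_Ratio _ dr0) (denom_Ratio _ dr0) mulrC.
Qed.

Notation "'Cxy' R" := {fraction {mpoly R[i][2]}} (at level 8, R at level 2).

Section Constants.
Variable R : realType.
Definition Kconst : {rmorphism R[i] -> Cxy R} :=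
  (@FracField.tofrac {mpoly R[i][2]} \o @mpolyC 2 R[i]).
Definition Kx : Cxy R := FracField.tofrac ('X_0 : {mpoly R[i][2]}).
Definition Ky : Cxy R := FracField.tofrac ('X_1 : {mpoly R[i][2]}).
End Constants.
Arguments Kconst {R}.
Arguments Kx {R}.
Arguments Ky {R}.

HB.lock Definition meval_at (R : realType) (n : nat) (v : n.-tuple (Cxy R))
  (F : {mpoly R[i][n]}) : Cxy R := mmap Kconst (tnth v) F.

(* P(z) for P in C(x) and z in C(x,y): the value of the numerator divided by
   that of the denominator, meaningful when the latter does not vanish at z. *)
HB.lock Definition uni_subst (R : realType) (P : {fraction {poly R[i]}})
    (z : Cxy R) : Cxy R :=
  (map_poly Kconst \n_(repr P)).[z] / (map_poly Kconst \d_(repr P)).[z].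

(* r(p,q) for r in C(x,y) and f = (p,q), with the same proviso; the denominator
   of r never vanishes at (p,q) when f is birational, see
   [mutual_inverse_nondeg] below. *)
HB.lock Definition pair_subst (R : realType) (f : Cxy R * Cxy R) (r : Cxy R) :
    Cxy R :=
  meval_at [tuple f.1; f.2] \n_(repr r) / meval_at [tuple f.1; f.2] \d_(repr r).

Section RationalMaps.
Variable R : realType.
Local Notation C := R[i].
Local Notation K := (Cxy R).

Lemma meval_atE n (v : n.-tuple K) F : meval_at v F = mmap Kconst (tnth v) F.
Proof. by rewrite meval_at.unlock. Qed.

Lemma pair_substE (f : K * K) r : pair_subst f r =
  meval_at [tuple f.1; f.2] \n_(repr r) / meval_at [tuple f.1; f.2] \d_(repr r).
Proof. by rewrite pair_subst.unlock. Qed.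

Fact meval_at_is_zmod_morphism n (v : n.-tuple K) : zmod_morphism (meval_at v).
Proof. by move=> F G; rewrite !meval_atE rmorphB. Qed.
HB.instance Definition _ n (v : n.-tuple K) :=
  GRing.isZmodMorphism.Build _ _ (meval_at v) (meval_at_is_zmod_morphism v).

Fact meval_at_is_monoid_morphism n (v : n.-tuple K) :
  monoid_morphism (meval_at v).
Proof. by split=> [|F G]; rewrite !meval_atE ?rmorph1 ?rmorphM. Qed.
HB.instance Definition _ n (v : n.-tuple K) :=
  GRing.isMonoidMorphism.Build _ _ (meval_at v) (meval_at_is_monoid_morphism v).

(* f after g *)
Definition rat_comp (f g : K * K) : K * K :=
  (pair_subst g f.1, pair_subst g f.2).

Definition rat_id : K * K := (Kx, Ky).

Definition mutual_inverse (fg : (K * K) * (K * K)) : bool :=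
  (rat_comp fg.1 fg.2 == rat_id) && (rat_comp fg.2 fg.1 == rat_id).

Lemma mutual_inverseC f g : mutual_inverse (f, g) = mutual_inverse (g, f).
Proof. exact: andbC. Qed.

(* p and q are algebraically independent over C, for f = (p,q). *)
Definition nondeg (f : K * K) : Prop :=
  forall D, D != 0 -> meval_at [tuple f.1; f.2] D != 0.

Lemma meval_id (D : {mpoly C[2]}) :
  meval_at [tuple Kx; Ky] D = FracField.tofrac D.
Proof.
rewrite [in RHS](mpolyE D) rmorph_sum /= meval_atE /mmap.
apply: eq_bigr => m _; rewrite -mul_mpolyC rmorphM /=; congr (_ * _).
rewrite /mmap1 mpolyXE_id rmorph_prod; apply: eq_bigr => i _ /=.
rewrite rmorphXn /=; congr (_ ^+ _); move: i; case=> [[|[|//]]] Hi.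
- by rewrite (tnth_nth 0) /= /Kx; congr (FracField.tofrac 'X_ _); apply: val_inj.
- by rewrite (tnth_nth 0) /= /Ky; congr (FracField.tofrac 'X_ _); apply: val_inj.
Qed.

Lemma pair_subst_frac f (n d : {mpoly C[2]}) : nondeg f -> d != 0 ->
  pair_subst f (FracField.tofrac n / FracField.tofrac d) =
  meval_at [tuple f.1; f.2] n / meval_at [tuple f.1; f.2] d.
Proof.
move=> nf d0; rewrite pair_substE.
set r := FracField.tofrac n / _; set a := \n_(repr r); set b := \d_(repr r).
have b0 : b != 0 by exact: denom_ratioP.
have /eqP := frac_numden r; rewrite -/a -/b /r.
rewrite eqr_div ?tofrac_eq0 // -!tofracM tofrac_eq => /eqP/esym E.
have := congr1 (meval_at [tuple f.1; f.2]) E; rewrite !rmorphM /= => E'.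
by apply/eqP; rewrite eqr_div ?nf // E'.
Qed.

Lemma pair_subst_poly f (n : {mpoly C[2]}) : nondeg f ->
  pair_subst f (FracField.tofrac n) = meval_at [tuple f.1; f.2] n.
Proof.
move=> nf; rewrite -[FracField.tofrac n]divr1.
rewrite -[X in _ / X](rmorph1 (@FracField.tofrac {mpoly C[2]})).
by rewrite (pair_subst_frac _ nf (oner_neq0 _)) [meval_at _ 1]rmorph1 divr1.
Qed.

Lemma rational_inverse (u v : {rmorphism {mpoly C[2]} -> K}) :
  (forall c, u c%:MP = Kconst c) -> (forall c, v c%:MP = Kconst c) ->
  (forall i, exists a b, [/\ u b != 0,
     v 'X_i = FracField.tofrac a / FracField.tofrac b &
     FracField.tofrac 'X_i = u a / u b]) ->
  forall D, exists a b, [/\ u b != 0,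
     v D = FracField.tofrac a / FracField.tofrac b &
     FracField.tofrac D = u a / u b].
Proof.
move=> uC vC goodX; pose good D := exists a b, [/\ u b != 0,
     v D = FracField.tofrac a / FracField.tofrac b &
     FracField.tofrac D = u a / u b].
have nz b : u b != 0 -> FracField.tofrac b != 0.
  by rewrite tofrac_eq0; apply: contraNneq => ->; rewrite rmorph0.
have goodM D E : good D -> good E -> good (D * E).
  move=> [a [b [b0 va ua]]] [c [d [d0 vc uc]]]; exists (a * c), (b * d); split.
  - rewrite [u _]rmorphM; exact: mulf_neq0 b0 d0.
  - by rewrite [v _]rmorphM va vc mulf_div !tofracM.
  - by rewrite tofracM ua uc mulf_div -[u a * _]rmorphM -[u b * _]rmorphM.
have goodD D E : good D -> good E -> good (D + E).
  move=> [a [b [b0 va ua]]] [c [d [d0 vc uc]]].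
  exists (a * d + c * b), (b * d); split.
  - rewrite [u _]rmorphM; exact: mulf_neq0 b0 d0.
  - by rewrite [v _]rmorphD va vc (addf_div _ _ (nz _ b0) (nz _ d0)) tofracD !tofracM.
  - rewrite tofracD ua uc (addf_div _ _ b0 d0).
    by rewrite [u (_ + _)]rmorphD ![u (_ * _)]rmorphM.
have goodC c : good c%:MP.
  exists c%:MP, 1; split.
  - by rewrite [u 1]rmorph1 oner_neq0.
  - by rewrite vC tofrac1 divr1.
  - by rewrite uC [u 1]rmorph1 divr1.
have good1 : good 1 by exact: (goodC).
move=> D; rewrite -/(good D) (mpolyE D); apply: (big_ind good); [|exact: goodD|].
  by rewrite -(mpolyC0 2 C); apply: goodC.
move=> m _; rewrite -mul_mpolyC; apply: (goodM); first exact: (goodC).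
rewrite mpolyXE_id; apply: (big_ind good); [exact: good1|exact: goodM|move=> i _].
elim: (m i) => [|k IH]; first by rewrite expr0.
by rewrite exprS; apply: (goodM).
Qed.

Lemma meval_atC n (v : n.-tuple K) c : meval_at v c%:MP = Kconst c.
Proof. by rewrite meval_atE mmapC. Qed.

Lemma meval_atX n (v : n.-tuple K) i : meval_at v 'X_i = tnth v i.
Proof. by rewrite meval_atE mmapX mmap1U. Qed.

Lemma mutual_inverse_nondeg f g : mutual_inverse (f, g) -> nondeg g.
Proof.
case/andP=> _ /= /eqP[]; rewrite !pair_substE => gx gy.
have inv i : exists a b, [/\ meval_at [tuple f.1; f.2] b != 0,
     meval_at [tuple g.1; g.2] 'X_i = FracField.tofrac a / FracField.tofrac b &
     FracField.tofrac 'X_i =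
       meval_at [tuple f.1; f.2] a / meval_at [tuple f.1; f.2] b].
  have X0 (i0 : 'I_2) : FracField.tofrac ('X_i0 : {mpoly C[2]}) != 0.
    rewrite tofrac_eq0; apply/eqP => /(congr1 (fun p => p@_U_(i0)%MM)).
    by rewrite mcoeffX eqxx mcoeff0 => /eqP; rewrite oner_eq0.
  have dn (z w : K) : z / w != 0 -> w != 0.
    by apply: contraNneq => ->; rewrite invr0 mulr0.
  rewrite meval_atX; move: i; case=> [[|[|//]]] Hi.
  - have -> : Ordinal Hi = 0 by apply: val_inj.
    exists \n_(repr g.1), \d_(repr g.1); split; [|exact: frac_numden|by rewrite gx].
    by apply: (@dn (meval_at [tuple f.1; f.2] \n_(repr g.1))); rewrite gx X0.
  - have -> : Ordinal Hi = 1 by apply: val_inj.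
    exists \n_(repr g.2), \d_(repr g.2); split; [|exact: frac_numden|by rewrite gy].
    by apply: (@dn (meval_at [tuple f.1; f.2] \n_(repr g.2))); rewrite gy X0.
move=> D; apply: contra_neq => D0.
have [a [b [b0 va ua]]] := rational_inverse (meval_atC _) (meval_atC _) inv D.
have nb : FracField.tofrac b != 0.
  by rewrite tofrac_eq0; apply: contraNneq b0 => ->; rewrite rmorph0.
move: (etrans (esym va) D0) => /eqP.
rewrite mulf_eq0 invr_eq0 (negbTE nb) orbF tofrac_eq0 => /eqP a0.
by apply/eqP; rewrite -tofrac_eq0 ua a0 rmorph0 mul0r.
Qed.

Lemma pair_subst_meval f g n (v : n.-tuple K) (F : {mpoly C[n]}) :
  mutual_inverse (f, g) ->
  pair_subst g (meval_at v F) = meval_at (map_tuple (pair_subst g) v) F.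
Proof.
move=> /mutual_inverse_nondeg gn.
have sub (r s : K) : exists n1 d1 n2 d2 : {mpoly C[2]},
  [/\ r = FracField.tofrac n1 / FracField.tofrac d1,
      s = FracField.tofrac n2 / FracField.tofrac d2, d1 != 0 & d2 != 0].
  exists \n_(repr r), \d_(repr r), \n_(repr s), \d_(repr s).
  split; [exact: frac_numden|exact: frac_numden| |]; exact: denom_ratioP.
have sM r s : pair_subst g (r * s) = pair_subst g r * pair_subst g s.
  have [a [b [c [d [-> -> b0 d0]]]]] := sub r s.
  rewrite mulf_div -!tofracM (pair_subst_frac _ gn b0) (pair_subst_frac _ gn d0).
  by rewrite (pair_subst_frac _ gn (mulf_neq0 b0 d0)) !rmorphM /= mulf_div.
have sD r s : pair_subst g (r + s) = pair_subst g r + pair_subst g s.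
  have [a [b [c [d [-> -> b0 d0]]]]] := sub r s.
  have tb : FracField.tofrac b != 0 by rewrite tofrac_eq0.
  have td : FracField.tofrac d != 0 by rewrite tofrac_eq0.
  rewrite (addf_div _ _ tb td) -!tofracM -tofracD.
  rewrite (pair_subst_frac _ gn b0) (pair_subst_frac _ gn d0).
  rewrite (pair_subst_frac _ gn (mulf_neq0 b0 d0)) rmorphD !rmorphM /=.
  by rewrite (addf_div _ _ (gn _ b0) (gn _ d0)).
have sC c : pair_subst g (Kconst c) = Kconst c.
  by rewrite [Kconst c]/(FracField.tofrac _) pair_subst_poly // meval_atC.
rewrite !meval_atE /mmap; elim/big_rec2: _ => [|m x y _ <-].
  by rewrite -(rmorph0 Kconst) sC.
rewrite sD sM sC; congr (_ * _ + _); rewrite /mmap1.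
elim/big_rec2: _ => [|i x1 y1 _ <-]; first by rewrite -(rmorph1 Kconst) sC.
rewrite sM tnth_map; congr (_ * _).
elim: (m i) => [|k IH]; first by rewrite !expr0 -(rmorph1 Kconst) sC.
by rewrite !exprS sM IH.
Qed.

Lemma pair_subst_div f g r s : mutual_inverse (f, g) ->
  pair_subst g (r / s) = pair_subst g r / pair_subst g s.
Proof.
move=> /mutual_inverse_nondeg gn.
have br : \d_(repr r) != 0 := denom_ratioP (repr r).
have bs : \d_(repr s) != 0 := denom_ratioP (repr s).
rewrite [pair_subst g r]pair_substE [pair_subst g s]pair_substE.
rewrite {1}[r]frac_numden {1}[s]frac_numden.
have [n0|n0] := eqVneq \n_(repr s) 0.
  rewrite n0 [meval_at _ 0]rmorph0 tofrac0 !mul0r !invr0 !mulr0.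
  rewrite -[X in pair_subst g X](mul0r (FracField.tofrac 1)^-1) -tofrac0.
  by rewrite (pair_subst_frac _ gn (oner_neq0 _)) rmorph0 mul0r.
rewrite !invf_div !mulf_div -!tofracM (pair_subst_frac _ gn (mulf_neq0 br n0)).
by rewrite !rmorphM.
Qed.

Lemma rat_compA f g h g' h' :
  mutual_inverse (g', g) -> mutual_inverse (h', h) ->
  rat_comp f (rat_comp g h) = rat_comp (rat_comp f g) h.
Proof.
move=> ig ih; have sub r : pair_subst (rat_comp g h) r =
    pair_subst h (pair_subst g r).
  rewrite [pair_subst g r]pair_substE (pair_subst_div _ _ ih).
  rewrite !(pair_subst_meval _ _ ih) pair_substE.
  have -> // : map_tuple (pair_subst h) [tuple g.1; g.2] =
    [tuple (rat_comp g h).1; (rat_comp g h).2].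
  exact: val_inj.
by rewrite /rat_comp /= !sub.
Qed.

Lemma rat_id_nondeg : nondeg rat_id.
Proof. by move=> D; rewrite meval_id tofrac_eq0. Qed.

Lemma pair_subst_id r : pair_subst rat_id r = r.
Proof. by rewrite pair_substE !meval_id -frac_numden. Qed.

Lemma rat_comp_id f : rat_comp f rat_id = f.
Proof. by rewrite /rat_comp !pair_subst_id -surjective_pairing. Qed.

Lemma rat_id_comp f g : mutual_inverse (f, g) -> rat_comp rat_id g = g.
Proof.
move=> /mutual_inverse_nondeg gn; rewrite /rat_comp /= /Kx /Ky.
by rewrite !pair_subst_poly // !meval_atX !(tnth_nth 0) /= -surjective_pairing.
Qed.

Lemma mutual_inverse_id : mutual_inverse (rat_id, rat_id).
Proof. by rewrite /mutual_inverse /= rat_comp_id eqxx. Qed.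

Lemma mutual_inverse_comp f f' g g' :
  mutual_inverse (f, f') -> mutual_inverse (g, g') ->
  mutual_inverse (rat_comp f g, rat_comp g' f').
Proof.
suff H u u' v v' : mutual_inverse (u, u') -> mutual_inverse (v, v') ->
    rat_comp (rat_comp u v) (rat_comp v' u') = rat_id.
  move=> If Ig; have If' := If; have Ig' := Ig.
  rewrite mutual_inverseC in If'; rewrite mutual_inverseC in Ig'.
  by apply/andP; split; apply/eqP; [exact: H If Ig | exact: H Ig' If'].
move=> Iu Iv; have Iv' := Iv; rewrite mutual_inverseC in Iv'.
have /andP[/eqP/= uK _] := Iu; have /andP[/eqP/= vK _] := Iv.
rewrite (rat_compA _ Iv Iu) -(rat_compA u Iv' Iv) vK.
by rewrite rat_comp_id uK.
Qed.

End RationalMaps.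

(* A birational self-map of the projective plane is given, in the affine chart
   [x : y : 1], by a pair of rational functions; it is packaged with its
   inverse, which is determined by the map. *)

Record Bir (R : realType) : Type := MkBir {
  Birval : (Cxy R * Cxy R) * (Cxy R * Cxy R);
  Bir_inverse : mutual_inverse Birval }.

Section Bir.
Variable R : realType.

HB.instance Definition _ := [isSub for @Birval R].
HB.instance Definition _ := [Choice of Bir R by <:].

Definition bir_map (f : Bir R) : Cxy R * Cxy R := (Birval f).1.
Definition bir_inv_map (f : Bir R) : Cxy R * Cxy R := (Birval f).2.

Fact BirP (f : Bir R) : mutual_inverse (bir_map f, bir_inv_map f).
Proof. by rewrite -surjective_pairing; case: f. Qed.

Definition Bir_one : Bir R := MkBir (mutual_inverse_id R).
Definition Bir_mul (f g : Bir R) : Bir R :=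
  MkBir (mutual_inverse_comp (BirP f) (BirP g)).

Fact Bir_inv_subproof (f : Bir R) : mutual_inverse (bir_inv_map f, bir_map f).
Proof. by rewrite mutual_inverseC BirP. Qed.
Definition Bir_inv (f : Bir R) : Bir R := MkBir (Bir_inv_subproof f).

Lemma mutual_inverse_unique (f g g' : Cxy R * Cxy R) :
  mutual_inverse (f, g) -> mutual_inverse (f, g') -> g = g'.
Proof.
move=> Ig Ig'; have If := Ig; rewrite mutual_inverseC in If.
have /andP[/eqP/= fg /eqP/= gf] := Ig; have /andP[/eqP/= fg' _] := Ig'.
by rewrite -(rat_comp_id g) -fg' (rat_compA _ If Ig') gf (rat_id_comp Ig').
Qed.

Lemma bir_map_inj : injective bir_map.
Proof.
move=> [[f f'] If] [[g g'] Ig] /= fg; apply: val_inj => /=.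
have {fg} fg : f = g := fg; subst g.
by rewrite (mutual_inverse_unique If Ig).
Qed.

Lemma bir_mapM f g : bir_map (Bir_mul f g) = rat_comp (bir_map f) (bir_map g).
Proof. by []. Qed.

Fact Bir_mulA : associative Bir_mul.
Proof.
move=> f g h; apply: bir_map_inj; rewrite !bir_mapM.
by rewrite (rat_compA _ (Bir_inv_subproof g) (Bir_inv_subproof h)).
Qed.
Fact Bir_mul1 : left_id Bir_one Bir_mul.
Proof.
by move=> f; apply: bir_map_inj; exact: rat_id_comp (Bir_inv_subproof f).
Qed.
Fact Bir_mulr1 : right_id Bir_one Bir_mul.
Proof. by move=> f; apply: bir_map_inj; exact: rat_comp_id. Qed.
Fact Bir_mulV : left_inverse Bir_one Bir_inv Bir_mul.
Proof.
by move=> f; apply: bir_map_inj; have /andP[_ /eqP] := BirP f.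
Qed.
Fact Bir_mulrV : right_inverse Bir_one Bir_inv Bir_mul.
Proof.
by move=> f; apply: bir_map_inj; have /andP[/eqP] := BirP f.
Qed.

HB.instance Definition _ := isGroup.Build (Bir R)
  Bir_mulA Bir_mul1 Bir_mulr1 Bir_mulV Bir_mulrV.

End Bir.

Section Parabolic.
Variable R : realType.
Local Notation C := R[i].

Definition no_common_factor (F0 F1 F2 : {mpoly C[3]}) : Prop :=
  forall G H0 H1 H2 : {mpoly C[3]},
    F0 = G * H0 -> F1 = G * H1 -> F2 = G * H2 -> G \is a GRing.unit.

(* [d] is the degree of [f]: on P^2 the map is [F0 : F1 : F2], so that its
   affine components are F0/F2 and F1/F2 evaluated at (x,y,1). *)
Definition has_degree (f : Bir R) (d : nat) : Prop :=
  exists F0 F1 F2 : {mpoly C[3]},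
    let ev := meval_at [tuple Kx; Ky; 1] in
    [/\ [/\ F0 \is d.-homog, F1 \is d.-homog & F2 \is d.-homog],
        no_common_factor F0 F1 F2, ev F2 != 0 &
        bir_map f = (ev F0 / ev F2, ev F1 / ev F2)].

(* u(n) has the exact order of growth n^k. *)
Definition grows_as_power (u : nat -> nat) (k : nat) : Prop :=
  exists A B n0 : nat, forall n, (n0 <= n)%N ->
    (n ^ k <= A * u n)%N /\ (u n <= B * n ^ k)%N.

Definition parabolic (f : Bir R) : Prop :=
  exists2 u : nat -> nat, forall n, has_degree (f ^+ n)%g (u n) &
    grows_as_power u 1 \/ grows_as_power u 2.

Definition infinite_order (f : Bir R) : Prop :=
  forall n : nat, (0 < n)%N -> (f ^+ n)%g <> 1%g.

Definition parabolic_embedding (theta : {multiplicative SL2Z -> Bir R}) : Prop :=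
  injective theta /\
  forall M : SL2Z, infinite_order (theta M) -> parabolic (theta M).

Definition is_theta (P : {fraction {poly C}})
    (theta : {multiplicative SL2Z -> Bir R}) : Prop :=
  bir_map (theta matS) = (- Kx^-1, Kconst 'i%C * Ky) /\
  bir_map (theta (matR * matS)%g) =
    ((Kx - 1) / Kx, Ky * (uni_subst P ((Kx - 1) / Kx) / uni_subst P Kx)).

End Parabolic.

(* Main.v *)
Require Import Defs.
From HB Require Import structures.
From mathcomp Require Import all_boot all_order all_algebra.
From mathcomp Require Import reals complex mpoly.
From mathcomp Require boolp.
From mathcomp Require Import ring lra zify.

Set Implicit Arguments.
Unset Strict Implicit.
Unset Printing Implicit Defensive.

Import Order.TTheory GRing.Theory Num.Theory.
Local Open Scope ring_scope.

(** Write A for RS, of order 3.  An element M of SL(2,Z) acts by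
    (x, y) |-> (Mx, y c_M(x)) with c_M a nonzero rational function of x, and
    the composition of maps becomes the cocycle rule
    c_(MN)(x) = c_N(x) c_M(Nx).  Here c_S = i and c_A(x) = P(Ax)/P(x).

    Existence comes from the presentation of SL(2,Z) ([SL2Z_presentation]).
    With the relations at hand every product of generators can be brought to
    the form S^j t_1 ... t_n A^k, where each t_l is AS or A^2 S.  These two
    matrices are, up to sign, the elementary unipotent ones, with nonnegative
    entries; hence a nonempty product of letters is never 1 or -1, and the
    normal form is unique.

    For the growth of degrees, the degree of the map (Mx, y c_M) of the plane
    differs from the degree of the rational function c_M by at most 2
    ([degree_upper], [degree_lower]), and the degree of c_M is subadditive in M.
    Up to conjugation and sign, an element of infinite order is a nonempty
    product t_1 ... t_n of letters ([SL2Z_torsion_or_word]).  The cocycle rule gives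
    c_(t_1 ... t_n)(x) =
      i^n prod_l P(t_l t_(l+1) ... t_n x) / P(S t_(l+1) ... t_n x).
    Let a be a zero of P.  The orbit of a meets the zeros and poles of P only in
    a, where P vanishes to order 1, and only 1 and -1 fix a.  So at the point
    p_l = (t_l ... t_n)^-1 a the l-th numerator vanishes to order 1, and any
    other factor with a zero or a pole at p_l would yield a nonempty product of
    letters equal to 1 or -1, or a product of letters equal to S or -S; neither
    exists.  The p_l are distinct for the same reason.  Thus c_(t_1 ... t_n)
    has at least n zeros and degree at least n ([degree_word]), and the degrees
    of the powers of M grow linearly.

    Finally the action on x determines M up to sign, and -1 = S^2 acts by
    (x, -y); so the homomorphism is injective. *)

(** * Matrices in SL(2,Z) *)

Lemma ord2P (k : 'I_2) : k = 0 \/ k = 1.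
Proof. by case: k => [[|[|//]]] ?; [left|right]; apply: val_inj. Qed.

Lemma SL2Z_eqP (M N : SL2Z) :
  M 0 0 = N 0 0 -> M 0 1 = N 0 1 -> M 1 0 = N 1 0 -> M 1 1 = N 1 1 -> M = N.
Proof.
move=> e00 e01 e10 e11; apply: val_inj; apply/matrixP => i j.
by case: (ord2P i) => ->; case: (ord2P j) => ->.
Qed.

Lemma SL2Z_mulE (M N : SL2Z) (i j : 'I_2) :
  (M * N)%g i j = M i 0 * N 0 j + M i 1 * N 1 j.
Proof.
have -> : (1 : 'I_2) = lift 0 0 by apply: val_inj.
by rewrite /= mxE !big_ord_recl big_ord0 addr0.
Qed.

Lemma det_mx22 (M : 'M[int]_2) : \det M = M 0 0 * M 1 1 - M 0 1 * M 1 0.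
Proof.
rewrite (expand_det_row _ 0) !big_ord_recl big_ord0 /cofactor !det_mx11 !mxE /=.
have -> : lift 0 0 = 1 :> 'I_2 by apply: val_inj.
have -> : lift 1 0 = 0 :> 'I_2 by apply: val_inj.
rewrite expr0 expr1; ring.
Qed.

Lemma SL2Z_detE (M : SL2Z) : M 0 0 * M 1 1 - M 0 1 * M 1 0 = 1.
Proof. by rewrite -det_mx22; exact/eqP/SL2Z_det. Qed.

Lemma SL2Z_1E (i j : 'I_2) : (1%g : SL2Z) i j = (i == j)%:R.
Proof. by rewrite /= mxE. Qed.

Lemma matRE (i j : 'I_2) : matR i j = nth 0 (nth [::] [:: [:: 1; 1]; [:: 0; 1]] i) j.
Proof. by rewrite /= mxE. Qed.

Lemma matSE (i j : 'I_2) : matS i j = nth 0 (nth [::] [:: [:: 0; 1]; [:: -1; 0]] i) j.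
Proof. by rewrite /= mxE. Qed.

(** The matrix RS, through its entries: a product would be taken apart by
    rewriting with associativity. *)
Fact matA_subproof : \det (mx22 (-1) 1 (-1) 0) == 1.
Proof. by rewrite det_mx22 !mxE. Qed.
Definition matA : SL2Z := MkSL2Z matA_subproof.

Lemma matAE (i j : 'I_2) : matA i j = nth 0 (nth [::] [:: [:: -1; 1]; [:: -1; 0]] i) j.
Proof. by rewrite /= mxE. Qed.

Definition sl2E := (SL2Z_mulE, SL2Z_1E, matRE, matSE, matAE).

Lemma mulRS : (matR * matS)%g = matA.
Proof. by apply: SL2Z_eqP; rewrite !sl2E. Qed.

Lemma SL2Z_invE (M : SL2Z) :
  [/\ (M^-1)%g 0 0 = M 1 1, (M^-1)%g 0 1 = - M 0 1,
      (M^-1)%g 1 0 = - M 1 0 & (M^-1)%g 1 1 = M 0 0].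
Proof.
have D := SL2Z_detE M.
have d : \det (mx22 (M 1 1) (- M 0 1) (- M 1 0) (M 0 0)) == 1.
  rewrite det_mx22 !mxE /=; apply/eqP; rewrite -[RHS]D; ring.
have -> : (M^-1)%g = MkSL2Z d.
  apply: mulg1_eq; apply: SL2Z_eqP; rewrite !sl2E !mxE /= -?[RHS]D; ring.
by rewrite /= !mxE.
Qed.

Lemma matS_mulE (M : SL2Z) (j : 'I_2) :
  ((matS * M)%g 0 j = M 1 j) * ((matS * M)%g 1 j = - M 0 j).
Proof. by split; rewrite !SL2Z_mulE !matSE /=; ring. Qed.

Lemma matA_mulE (M : SL2Z) (j : 'I_2) :
  ((matA * M)%g 0 j = - M 0 j + M 1 j) * ((matA * M)%g 1 j = - M 0 j).
Proof. by split; rewrite !SL2Z_mulE !matAE /=; ring. Qed.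

Definition sl2_mulE := (matS_mulE, matA_mulE, SL2Z_1E).

Lemma matA3 : (matA ^+ 3)%g = 1%g.
Proof.
rewrite !expgS -[(matA ^+ 0)%g]/(1%g).
by apply: SL2Z_eqP; rewrite !sl2_mulE.
Qed.

Lemma matS4 : (matS ^+ 4)%g = 1%g.
Proof.
rewrite !expgS -[(matS ^+ 0)%g]/(1%g).
by apply: SL2Z_eqP; rewrite !sl2_mulE.
Qed.

Lemma matS2E (M : SL2Z) (i j : 'I_2) : (matS ^+ 2 * M)%g i j = - M i j.
Proof.
have -> : (matS ^+ 2 * M = matS * (matS * M))%g by rewrite mulgA.
by case: (ord2P i) => ->; rewrite !sl2_mulE.
Qed.

(** * Words and normal forms *)

Section Words.
Local Open Scope group_scope.
Variables (G : groupType) (s a : G).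

(** a^2 plays the role of a^-1, so that every word is a product of generators.
    For s = S and a = RS the letter AS is -R, and A^2 S is the transpose of R. *)
Definition letter (b : bool) : G := (if b then a else a ^+ 2) * s.
Definition word (w : seq bool) : G := foldr (fun b g => letter b * g) 1 w.
Definition normal_form (j : nat) (w : seq bool) (k : nat) : G :=
  s ^+ j * word w * a ^+ k.

Lemma word_cat u v : word (u ++ v) = word u * word v.
Proof. by elim: u => [|b u IH] /=; rewrite ?mul1g // IH mulgA. Qed.

Lemma word_rcons u b : word (rcons u b) = word u * letter b.
Proof. by rewrite -cats1 word_cat /= mulg1. Qed.

Lemma word_nseq n w : word (flatten (nseq n w)) = word w ^+ n.
Proof. by elim: n => [|n IH] //=; rewrite word_cat IH expgS. Qed.

Hypotheses (a3 : a ^+ 3 = 1) (s2a : commute (s ^+ 2) a).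

Lemma s2_word w : commute (s ^+ 2) (word w).
Proof.
elim: w => [|b w IH] /=; first exact: commute1.
apply: commuteM IH; apply: commuteM; last by apply/commute_sym/commuteX.
by case: b => //; apply: commuteX.
Qed.

Lemma normal_form_mula j w k :
  normal_form j w k * a = normal_form j w (if k == 2 then 0 else k.+1).
Proof.
rewrite /normal_form -mulgA -expgSr; case: eqP => // ->.
by rewrite a3.
Qed.

(** Multiplying a normal form by s on the right either completes a last power of
    a to a letter, or cancels the s of the last letter into the central s^2. *)
Definition mul_s (j : nat) (w : seq bool) (k : nat) : nat * seq bool * nat :=
  match k with
  | 0 => if w is b :: w' then
           (j + 2, belast b w', if last b w' then 1 else 2) else (j + 1, [::], 0)
  | k'.+1 => (j, rcons w (k' == 0), 0)
  end%N.

Lemma normal_form_muls j w k : (k < 3)%N ->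
  normal_form j w k * s =
  normal_form (mul_s j w k).1.1 (mul_s j w k).1.2 (mul_s j w k).2.
Proof.
rewrite /normal_form; case: k => [|k] k3 /=.
  case: w => [|b w] /=; first by rewrite !mulg1 expgnDr.
  rewrite -[letter b * _]/(word (b :: w)) lastI word_rcons /letter.
  rewrite mulg1 -!mulgA -[s * s]expg2; set t := (if _ then a else _).
  have s2t : commute (s ^+ 2) t by rewrite /t; case: ifP => _ //; exact: commuteX.
  by rewrite -s2t [word _ * _]mulgA -s2_word expgnDr -!mulgA /t; case: ifP.
rewrite mulg1 word_rcons /letter -!mulgA; do 3!congr (_ * _).
by case: k k3 => [|[|]].
Qed.

Lemma mul_s_lt j w k : (k < 3)%N -> ((mul_s j w k).2 < 3)%N.
Proof. by case: k => [|k] //=; case: w => //= b w _; case: ifP. Qed.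

End Words.

(** The graph of the homomorphism to be constructed, before it is known to be
    total and single-valued. *)
Inductive generated (G : groupType) (s a : G) : SL2Z -> G -> Prop :=
| generated1 : generated s a 1%g 1%g
| generatedS M g : generated s a M g -> generated s a (M * matS)%g (g * s)%g
| generatedA M g : generated s a M g -> generated s a (M * matA)%g (g * a)%g.

Lemma matS2A : commute (matS ^+ 2)%g matA.
Proof.
rewrite /commute.
have -> : (matS ^+ 2 * matA = matS * (matS * (matA * 1)))%g.
  by rewrite (mulg1 matA) (mulgA matS).
have -> : (matA * matS ^+ 2 = matA * (matS * (matS * 1)))%g.
  by rewrite (mulg1 matS).
by apply: SL2Z_eqP; rewrite !sl2_mulE.
Qed.

(** Only a^3 = 1 and the centrality of s^2 serve to reach the normal form, so
    one normal form represents M and g simultaneously. *)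
Lemma generated_normal_form (G : groupType) (s a : G) M g :
  (a ^+ 3)%g = 1%g -> commute (s ^+ 2)%g a -> generated s a M g ->
  exists j w k, [/\ (k < 3)%N, M = normal_form matS matA j w k
                             & g = normal_form s a j w k].
Proof.
move=> a3 s2a; elim=> [|{}M {}g _ [j [w [k [k3 -> ->]]]]|{}M {}g _ [j [w [k [k3 -> ->]]]]].
- by exists 0, [::], 0%N; rewrite /normal_form /= !mulg1.
- exists (mul_s j w k).1.1, (mul_s j w k).1.2, (mul_s j w k).2; split.
  + exact: mul_s_lt k3.
  + by apply: normal_form_muls => //; exact: matS2A.
  + exact: normal_form_muls.
- exists j, w, (if k == 2 then 0 else k.+1)%N; split.
  + by case: (k =P 2) k3 => [_ _|]; [apply: (ltn0Sn 2) | lia].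
  + by apply: normal_form_mula; exact: matA3.
  + exact: normal_form_mula.
Qed.

Local Notation wordSA := (word matS matA).

Lemma letterSAE b (M : SL2Z) (j : 'I_2) :
  (letter matS matA b * M)%g 0 j = (if b then - (M 0 j + M 1 j) else M 0 j) /\
  (letter matS matA b * M)%g 1 j = (if b then - M 1 j else M 0 j + M 1 j).
Proof.
have -> : (letter matS matA b * M =
    if b then matA * (matS * M) else matA * (matA * (matS * M)))%g.
  by rewrite /letter; case: b; rewrite ?expg2 !mulgA.
by case: b; rewrite !sl2_mulE; split; ring.
Qed.

(** Both letters are, up to sign, nonnegative unipotent matrices.  By
    induction the diagonal entries of a product are at least 1, so each further
    letter increases the sum of the two other entries. *)
Lemma word_positive w : exists sg : int, (sg = 1 \/ sg = -1) /\
  [/\ 1 <= sg * wordSA w 0 0, 0 <= sg * wordSA w 0 1,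
      0 <= sg * wordSA w 1 0, 1 <= sg * wordSA w 1 1 &
      (size w)%:Z <= sg * (wordSA w 0 1 + wordSA w 1 0)].
Proof.
elim: w => [|b w [sg [sg1 [h00 h01 h10 h11 hs]]]].
  by exists 1; split; [left | rewrite !SL2Z_1E].
exists (if b then - sg else sg); split.
  by case: b; case: sg1 => ->; [right|left|left|right]; rewrite ?opprK.
have [e0 e1] := letterSAE b (wordSA w) 0; have [e2 e3] := letterSAE b (wordSA w) 1.
rewrite [wordSA _]/(letter matS matA b * wordSA w)%g e0 e1 e2 e3 /=.
move: h00 h01 h10 h11 hs; case: b {e0 e1 e2 e3} => /=; case: sg1 => ->; split; lia.
Qed.

Lemma matS2E1 (i j : 'I_2) : (matS ^+ 2)%g i j = - (i == j)%:R.
Proof. by have := matS2E 1%g i j; rewrite mulg1 SL2Z_1E. Qed.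

(** S^2 is the matrix -1, so this is the kernel of the map to PSL(2,Z). *)
Definition pm1 (M : SL2Z) : Prop := M = 1%g \/ M = (matS ^+ 2)%g.

Lemma pm1P (M : SL2Z) : (M : 'M[int]_2) = 1%:M \/ (M : 'M[int]_2) = - 1%:M -> pm1 M.
Proof.
case=> E; [left|right].
  by apply: SL2Z_eqP; rewrite SL2Z_1E E mxE.
by apply: SL2Z_eqP; rewrite matS2E1 E !mxE.
Qed.

Lemma word_pm1 w : pm1 (wordSA w) -> w = [::].
Proof.
have [sg [_ [_ _ _ _ hs]]] := word_positive w; case=> E; move: hs; rewrite E.
  by rewrite !SL2Z_1E /= addr0 mulr0; case: w {E}.
by rewrite !matS2E1 /= oppr0 addr0 mulr0; case: w {E}.
Qed.

Lemma word_S w j : wordSA w <> (matS ^+ (j.*2.+1))%g.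
Proof.
have [sg [_ [h _ _ _ _]]] := word_positive w => E; move: h; rewrite E.
suff -> : (matS ^+ j.*2.+1)%g 0 0 = 0 by rewrite mulr0.
elim: j {E} => [|j IH]; first by rewrite expg1 matSE.
have -> : (matS ^+ j.+1.*2.+1 = matS ^+ 2 * matS ^+ j.*2.+1)%g.
  by rewrite -expgnDr doubleS.
by rewrite matS2E IH oppr0.
Qed.

(** Otherwise a word would equal S^i or S^i A^l with 0 < l < 3, and each of
    these matrices violates the sign pattern of [word_positive]. *)
Lemma normal_form_eq1 j w k : (k < 3)%N ->
  normal_form matS matA j w k = 1%g -> [/\ (4 %| j)%N, w = [::] & k = 0%N].
Proof.
move=> k3 E.
have Sj i : (i < 4)%N -> (matS ^+ i)%g = 1%g -> i = 0%N.
  case: i => [|[|[|[|]]]] // _ E1; have : (1%g : SL2Z) 0 0 = 1 by rewrite SL2Z_1E.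
  - by rewrite -E1 expg1 matSE.
  - by rewrite -E1 matS2E1.
  - by rewrite -E1 (expgnDr _ 2 1) matS2E expg1 matSE.
have Smod i : (matS ^+ i = matS ^+ (i %% 4))%g.
  by rewrite {1}(divn_eq i 4) expgnDr mulnC expgnA matS4 expg1n mul1g.
have word_SA i l : (i < 4)%N -> (0 < l < 3)%N ->
    wordSA w <> (matS ^+ i * matA ^+ l)%g.
  have [sg [sg1 [h00 h01 h10 h11 _]]] := word_positive w => i4 l3 e.
  move: h00 h01 h10 h11; rewrite e {E e}.
  have iterE i' l' : (matS ^+ i' * matA ^+ l' =
      iter i' ( *%g matS) (iter l' ( *%g matA) 1))%g.
    by rewrite iter_mulg iter_mulg_1.
  rewrite iterE; case: l l3 => [|[|[|]]] // _; case: i i4 => [|[|[|[|]]]] // _;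
  rewrite /iter !sl2_mulE /=; case: sg1 => -> /=; lia.
have ew : wordSA w = (matS ^+ (4 - j %% 4) * matA ^+ (3 - k))%g.
  have e4 : (matS ^+ (4 - j %% 4) * matS ^+ j)%g = 1%g.
    rewrite (Smod j) -expgnDr subnK ?matS4 //; exact/ltnW/ltn_pmod.
  have e3 : (matA ^+ k * matA ^+ (3 - k))%g = 1%g.
    by rewrite -expgnDr subnKC ?matA3 // ltnW.
  rewrite -[LHS]mul1g -e4 -[(matA ^+ (3 - k))%g]mul1g -E.
  by rewrite /normal_form -!mulgA e3 mulg1.
rewrite Smod in ew.
have [k0|k0] := posnP k; last first.
  case: (word_SA ((4 - j %% 4) %% 4)%N (3 - k)%N) => //; first exact: ltn_pmod.
  by rewrite subn_gt0 k3 ltn_subrL k0.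
clear E; move: ew; rewrite k0 subn0 matA3 mulg1 /dvdn.
have j4 : (j %% 4 < 4)%N by exact: ltn_pmod.
have wS2 := @word_pm1 w.
case: (j %% 4)%N j4 => [|[|[|[|]]]] // _; rewrite /= ?expg0 => ew.
- by split=> //; apply: wS2; left.
- by case: (@word_S w 1).
- have w0 : w = [::] by apply: wS2; right.
  by have /(Sj 2%N isT) := etrans (esym ew) (congr1 wordSA w0).
- by case: (@word_S w 0).
Qed.

(** * Presentation of SL(2,Z) *)

Fact shear_subproof (n : int) : \det (mx22 1 n 0 1) == 1.
Proof. by rewrite det_mx22 !mxE /= mulr0 subr0. Qed.
Definition shear (n : int) : SL2Z := MkSL2Z (shear_subproof n).

Lemma shearE n (i j : 'I_2) :
  shear n i j = nth 0 (nth [::] [:: [:: 1; n]; [:: 0; 1]] i) j.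
Proof. by rewrite /= mxE. Qed.

Lemma shearD m n : shear (m + n) = (shear m * shear n)%g.
Proof. by apply: SL2Z_eqP; rewrite !sl2E !shearE /=; ring. Qed.

Lemma int_mul_eq1 (x y : int) : x * y = 1 -> x = 1 /\ y = 1 \/ x = -1 /\ y = -1.
Proof.
move=> xy; have /eqP := congr1 absz xy; rewrite abszM muln_eq1 => /andP[x1 _].
have [x1'|x1'] : x = 1 \/ x = -1 by lia.
  by move: xy; rewrite x1'; lia.
by move: xy; rewrite x1'; lia.
Qed.

Section Presentation.
Local Open Scope group_scope.
Variables (G : groupType) (s a : G).
Local Notation gen := (generated s a).

Lemma generatedM M g N h : gen M g -> gen N h -> gen (M * N) (g * h).
Proof.
move=> Mg; elim=> [|{}N {}h _ IH|{}N {}h _ IH]; rewrite ?mulg1 // !mulgA.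
  exact: generatedS.
exact: generatedA.
Qed.

Lemma generated_S : gen matS s.
Proof. by have := @generatedS G s a _ _ (@generated1 G s a); rewrite !mul1g. Qed.

Lemma generated_A : gen matA a.
Proof. by have := @generatedA G s a _ _ (@generated1 G s a); rewrite !mul1g. Qed.

Hypotheses (s4 : s ^+ 4 = 1) (a3 : a ^+ 3 = 1) (s2a : commute (s ^+ 2) a).

Lemma generatedV M g : gen M g -> gen M^-1 g^-1.
Proof.
elim=> [|{}M {}g _ IH|{}M {}g _ IH]; rewrite ?invg1 ?invgM; first exact: generated1.
  have -> : matS^-1 = matS * (matS * matS) by apply: mulg1_eq; exact: matS4.
  have -> : s^-1 = s * (s * s) by exact: mulg1_eq.
  by do !apply: generatedM => //; exact: generated_S.
have -> : matA^-1 = matA * matA by apply: mulg1_eq; exact: matA3.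
have -> : a^-1 = a * a by exact: mulg1_eq.
by do !apply: generatedM => //; exact: generated_A.
Qed.

(** The quotient of two values at M is a value at 1.  Its normal form has to
    be trivial in SL(2,Z), hence also in G. *)
Lemma generated_fun M g h : gen M g -> gen M h -> g = h.
Proof.
move=> Mg Mh; apply: divg1_eq.
have := generatedM Mg (generatedV Mh); rewrite mulgV.
case/(generated_normal_form a3 s2a) => j [w [k [k3 /esym]]].
case/(normal_form_eq1 k3) => /dvdnP[q ->] -> ->  ->.
by rewrite /normal_form !mulg1 mulnC expgnA s4 expg1n.
Qed.

Lemma generated_shear n : exists g, gen (shear n) g.
Proof.
have shear0 : shear 0%R = 1 by apply: SL2Z_eqP; rewrite !sl2E !shearE.
have shearN m : shear (- m)%R = (shear m)^-1.
  by apply/esym/mulg1_eq; rewrite -shearD subrr.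
have pos k : exists g, gen (shear k%:Z) g.
  elim: k => [|k [g IH]]; first by exists 1; rewrite shear0; constructor.
  have R1 : shear 1%R = matA * matS^-1.
    by rewrite -mulRS mulgK; apply: SL2Z_eqP; rewrite ?shearE ?matRE.
  exists (a * s^-1 * g); rewrite -addn1 addnC PoszD shearD R1.
  apply: generatedM IH; apply: generatedM; first exact: generated_A.
  exact: generatedV generated_S.
case: n => k; first exact: pos.
have [g kg] := pos k.+1; exists g^-1; rewrite NegzE shearN; exact: generatedV.
Qed.

(** Euclidean division on the first column: a shear reduces the upper left
    entry modulo the lower left one, and S exchanges the two rows. *)
Lemma generated_total M : exists g, gen M g.
Proof.
have [n] := ubnP `|M 1%R 0%R|%N; elim: n M => // n IH M Mn.
have [c0|c0] := eqVneq (M 1%R 0%R) 0%R.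
  have := SL2Z_detE M; rewrite c0 mulr0 subr0 => ad.
  have [[a1 d1]|[a1 d1]] := int_mul_eq1 ad.
    have -> : M = shear (M 0%R 1%R) by apply: SL2Z_eqP; rewrite shearE.
    exact: generated_shear.
  have [g ng] := generated_shear (- M 0 1)%R.
  exists (s ^+ 2 * g).
  have -> : M = matS ^+ 2 * shear (- M 0 1)%R.
    by apply: SL2Z_eqP; rewrite matS2E shearE /= ?opprK ?oppr0.
  by apply: generatedM ng; rewrite !expg2; apply: generatedM; exact: generated_S.
pose q := divz (M 0%R 0%R) (M 1%R 0%R).
have [|g hg] := IH (matS * (shear (- q)%R * M)).
  rewrite !sl2E !shearE /= !(mul0r, mul1r, add0r, addr0).
  have := divz_eq (M 0%R 0%R) (M 1%R 0%R).
  have := modz_ge0 (M 0%R 0%R) c0; have := ltz_mod (M 0%R 0%R) c0; rewrite -/q.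
  lia.
have [h qh] := generated_shear q.
exists (h * (s^-1 * g)).
have -> : M = shear q * (matS^-1 * (matS * (shear (- q)%R * M))).
  rewrite mulKg mulgA -shearD subrr; apply: SL2Z_eqP; rewrite !sl2E !shearE /=; ring.
apply: generatedM qh _; apply: generatedM hg; exact: generatedV generated_S.
Qed.

End Presentation.

Lemma SL2Z_presentation (G : groupType) (s a : G) :
  (s ^+ 4)%g = 1%g -> (a ^+ 3)%g = 1%g -> commute (s ^+ 2)%g a ->
  exists theta : {multiplicative SL2Z -> G}, theta matS = s /\ theta matA = a.
Proof.
move=> s4 a3 s2a.
have [th thP] := boolp.choice (generated_total s4 a3).
have thM : {morph th : M N / (M * N)%g >-> (M * N)%g}.
  move=> M N; apply: (generated_fun s4 a3 s2a (thP _)).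
  exact: generatedM (thP M) (thP N).
pose f : {multiplicative SL2Z -> G} :=
  HB.pack th (isMultiplicative.Build SL2Z G th thM).
exists f; split; apply: (generated_fun s4 a3 s2a (thP _)).
  exact: generated_S.
exact: generated_A.
Qed.

Lemma SL2Z_ind (P : SL2Z -> Prop) : P 1%g ->
  (forall M, P M -> P (M * matS)%g) -> (forall M, P M -> P (M * matA)%g) ->
  forall M, P M.
Proof.
move=> P1 PS PA M; have [g] := generated_total matS4 matA3 M.
by elim=> // {}M {}g _ IH; [apply: PS|apply: PA].
Qed.

Lemma matS2C M : commute (matS ^+ 2)%g M.
Proof.
rewrite /commute; apply: SL2Z_eqP;
rewrite matS2E SL2Z_mulE !matS2E1 /=; ring.
Qed.

(** * Conjugacy classes *)

Section Conjugacy.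
Local Open Scope group_scope.

(** 12 is a common multiple of the orders of S and of -A. *)
Definition torsion_or_word M : Prop := M ^+ 12 = 1 \/
  exists g i w, w <> [::] /\ M = (matS ^+ 2 ^+ i * wordSA w) ^ g.

Lemma torsion_or_wordJ M g :
  torsion_or_word (M ^ g) -> torsion_or_word M.
Proof.
case=> [M1|[h [i [w [w0 e]]]]]; [left|right].
  by apply: (@conjg_inj _ g); rewrite conjXg M1 conj1g.
by exists (h * g^-1), i, w; rewrite conjgM -e conjgK.
Qed.

Lemma matS_exp12 n : matS ^+ n ^+ 12 = 1.
Proof. by rewrite expgnAC (expgnA _ 4 3) matS4 !expg1n. Qed.

Lemma matA_exp12 n : matA ^+ n ^+ 12 = 1.
Proof. by rewrite expgnAC (expgnA _ 3 4) matA3 !expg1n. Qed.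

(** Conjugation makes a normal form cyclic, its last power of A meeting its
    first letter; cancellations shorten the word. *)
Lemma conjugacy_normal_form n j w k : (size w < n)%N -> (k < 3)%N ->
  torsion_or_word (normal_form matS matA j w k).
Proof.
elim: n j w k => // n IH j w k wn k3.
have zC M i : commute (matS ^+ 2 ^+ i) M.
  exact/commute_sym/commuteX/commute_sym/matS2C.
have Sj : matS ^+ j = matS ^+ 2 ^+ j./2 * matS ^+ odd j.
  by rewrite -[in LHS](odd_double_half j) expgnDr -mul2n expgnA zC.
set i := j./2 in Sj.
apply: (@torsion_or_wordJ _ (matA ^- k)).
have -> : normal_form matS matA j w k ^ (matA ^- k) =
    matS ^+ 2 ^+ i * (matA ^+ k * (matS ^+ odd j * wordSA w)).
  rewrite conjgE invgK /normal_form Sj mulgK -[_ * matS ^+ odd j * _]mulgA.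
  by rewrite [LHS](mulgA (matA ^+ k)) -zC -mulgA.
have AA l b u : matA ^+ l * wordSA (b :: u) =
    matA ^+ (l + if b then 1 else 2)%N * (matS * wordSA u).
  by rewrite /= /letter expgnDr; case: b; rewrite ?expg1 !mulgA.
have hyp b u : torsion_or_word (matS ^+ 2 ^+ i * wordSA (b :: u)).
  by right; exists 1, i, (b :: u); rewrite conjg1.
have letterE b u : wordSA (b :: u) =
    matA ^+ (if b then 1 else 2)%N * (matS * wordSA u).
  by rewrite -[LHS]mul1g -(expg0 matA) AA.
case: (odd j); rewrite ?expg1 ?mul1g.
- (* The element is A^k S T_w up to sign.  If k is not 0, then A^k S is a letter.
     Otherwise conjugation by S brings the S of the last letter to the front,
     where it meets the leading S in the central element S^2. *)
  case: k k3 => [|[|[|]]] // _; last first.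
  + by have := hyp false w; rewrite letterE.
  + by have := hyp true w; rewrite letterE.
  rewrite expg0 mul1g; case/lastP: w wn => [|w b] wn.
    by left; rewrite /= mulg1 -expgnA -expgSr matS_exp12.
  rewrite size_rcons in wn.
  apply: (@torsion_or_wordJ _ matS^-1).
  have -> : (matS ^+ 2 ^+ i * (matS * wordSA (rcons w b))) ^ matS^-1 =
     normal_form matS matA (i.+1).*2 w (if b then 1 else 2)%N.
    rewrite conjgE invgK word_rcons /letter /normal_form !mulgA mulgK.
    rewrite -(zC matS) doubleS -mul2n (expgSr _ (2 * i).+1) (expgSr _ (2 * i)) expgnA.
    by case: (b).
  by apply: IH; [exact: wn | case: (b)].
- (* The element is A^k T_w up to sign, and A^k is absorbed by the first letter,
     unless the two powers of A cancel. *)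
  case: w wn => [|b w] wn.
    left; rewrite /= mulg1 (expgMn _ (zC _ _)) matA_exp12.
    by rewrite -[matS ^+ 2 ^+ i]expgnA matS_exp12 mulg1.
  have can : torsion_or_word (matS ^+ 2 ^+ i * (matS * wordSA w)).
    have -> : matS ^+ 2 ^+ i * (matS * wordSA w) = normal_form matS matA i.*2.+1 w 0.
      by rewrite /normal_form mulg1 mulgA -mul2n (expgSr _ (2 * i)) expgnA.
    exact: IH.
  rewrite AA; have h1 := hyp true w; have h2 := hyp false w.
  rewrite !letterE in h1 h2.
  case: k k3 => [|[|[|]]] // _; case: (b) => //; rewrite /addn /=.
  + by rewrite matA3 mul1g.
  + by rewrite matA3 mul1g.
  + by rewrite (expgnDr _ 3 1) matA3 mul1g.
Qed.

Lemma SL2Z_torsion_or_word M : torsion_or_word M.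
Proof.
have [g Mg] := generated_total matS4 matA3 M.
have [j [w [k [k3 -> _]]]] := generated_normal_form matA3 (matS2C _) Mg.
exact: (conjugacy_normal_form _ (ltnSn _)).
Qed.
End Conjugacy.

(** * The function field C(x,y) *)

Section PolyAt.
Variable R : realType.
Local Notation C := R[i].
Local Notation K := (Cxy R).

Definition poly_at (z : K) (p : {poly C}) : K := (map_poly Kconst p).[z].

Fact poly_at_is_zmod_morphism z : zmod_morphism (poly_at z).
Proof. by move=> p q; rewrite /poly_at rmorphB hornerD hornerN. Qed.
HB.instance Definition _ z :=
  GRing.isZmodMorphism.Build _ _ (poly_at z) (poly_at_is_zmod_morphism z).

Fact poly_at_is_monoid_morphism z : monoid_morphism (poly_at z).
Proof. by split=> [|p q]; rewrite /poly_at ?rmorph1 ?hornerC // rmorphM hornerM. Qed.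
HB.instance Definition _ z :=
  GRing.isMonoidMorphism.Build _ _ (poly_at z) (poly_at_is_monoid_morphism z).

Lemma poly_atC z c : poly_at z c%:P = Kconst c.
Proof. by rewrite /poly_at map_polyC hornerC. Qed.

Lemma poly_atX z : poly_at z 'X = z.
Proof. by rewrite /poly_at map_polyX hornerX. Qed.

Lemma poly_atZ z c p : poly_at z (c *: p) = Kconst c * poly_at z p.
Proof. by rewrite -mul_polyC rmorphM /= poly_atC. Qed.

(** Since C is algebraically closed, this is the same as transcendence over C,
    see [poly_at_neq0]. *)
Definition nonconstant (z : K) : Prop := forall c, z <> Kconst c.

(** p splits into linear factors, and none of them vanishes at z. *)
Lemma poly_at_neq0 z p : nonconstant z -> p != 0 -> poly_at z p != 0.
Proof.
move=> zc p0; have [r ->] := closed_field_poly_normal p.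
rewrite poly_atZ mulf_neq0 ?fmorph_eq0 ?lead_coef_eq0 //.
rewrite rmorph_prod prodf_seq_neq0; apply/allP => c _ /=.
by rewrite rmorphB /= poly_atX poly_atC subr_eq0; apply/eqP/zc.
Qed.

Lemma poly_at_fmorph (f : {rmorphism K -> K}) z p :
  (forall c, f (Kconst c) = Kconst c) -> f (poly_at z p) = poly_at (f z) p.
Proof.
move=> fC; rewrite /poly_at -horner_map -map_poly_comp; congr (_.[_]).
exact: eq_map_poly.
Qed.

(** C[x][y] inside C(x,y), where degrees in x and in y are visible. *)
Definition poly2_at (q : {poly {poly C}}) : K := (map_poly (poly_at Kx) q).[Ky].

(** The image of q is a polynomial in two variables, and substituting the
    variables of C[x][y] gives q back. *)
Lemma poly2_at_inj : injective poly2_at.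
Proof.
pose ix : {rmorphism {poly C} -> {mpoly C[2]}} :=
  (horner_eval 'X_0 \o map_poly (@mpolyC 2 C)).
pose iy (q : {poly {poly C}}) : {mpoly C[2]} := (map_poly ix q).['X_1].
have tauE q : poly2_at q = FracField.tofrac (iy q).
  rewrite /poly2_at /iy -horner_map -map_poly_comp; congr (_.[_]).
  apply: eq_map_poly => p /=; rewrite /horner_eval.
  by rewrite -horner_map /= -map_poly_comp /poly_at.
pose chi : {rmorphism {mpoly C[2]} -> {poly {poly C}}} :=
  mmap (polyC \o polyC) (fun i => if i == 0 then 'X%:P else 'X).
have chiX i : chi 'X_i = if i == 0 then 'X%:P else 'X.
  by rewrite /chi /= mmapX mmap1U.
have chiC c : chi c%:MP = c%:P%:P by rewrite /chi /= mmapC.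
have polyCX (A : comNzRingType) (p : {poly A}) : (map_poly polyC p).['X] = p.
  exact: comp_polyXr.
have chix p : chi (ix p) = p%:P.
  rewrite [ix p]/((map_poly (@mpolyC 2 C) p).['X_0]) -horner_map -map_poly_comp chiX.
  rewrite -[in RHS](polyCX _ p) -horner_map -map_poly_comp; congr (_.[_]).
  by apply: eq_map_poly => c; rewrite [LHS]chiC.
have chiK : cancel iy chi.
  move=> q; rewrite /iy -horner_map -map_poly_comp chiX.
  rewrite -[RHS]polyCX; congr (_.[_]); apply: eq_map_poly => p; exact: chix.
move=> p q; rewrite !tauE => /eqP; rewrite tofrac_eq => /eqP.
exact: can_inj chiK _ _.
Qed.

End PolyAt.

(** * Moebius substitutions *)

Section Moebius.
Variable F : fieldType.
Implicit Types (M N : SL2Z) (z : F).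

Definition moeb_den M z : F := (M 1 0)%:~R * z + (M 1 1)%:~R.
Definition moeb M z : F := ((M 0 0)%:~R * z + (M 0 1)%:~R) / moeb_den M z.

Lemma SL2Z_det_intr M :
  (M 0 0)%:~R * (M 1 1)%:~R - (M 0 1)%:~R * (M 1 0)%:~R = 1 :> F.
Proof. by rewrite -!rmorphM -rmorphB /= SL2Z_detE. Qed.

Lemma moeb_denM M N z : moeb_den N z != 0 ->
  moeb_den (M * N)%g z = moeb_den M (moeb N z) * moeb_den N z.
Proof.
move=> N0; rewrite [LHS]/moeb_den !SL2Z_mulE !rmorphD !rmorphM /=.
rewrite [moeb_den M _]/moeb_den [RHS]mulrDl -[_ * _ * moeb_den _ _]mulrA.
rewrite /moeb divfK // /moeb_den; ring.
Qed.

Lemma moebM M N z : moeb_den N z != 0 ->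
  moeb (M * N)%g z = moeb M (moeb N z).
Proof.
move=> N0; rewrite [LHS]/moeb moeb_denM // !SL2Z_mulE !rmorphD !rmorphM /=.
have frac (a b v : F) : v != 0 -> a * v / (b * v) = a / b.
  by move=> v0; rewrite -mulf_div divff // mulr1.
rewrite -[RHS](frac _ _ (moeb_den N z)) //; congr (_ / _).
rewrite [RHS]mulrDl -[_ * _ * moeb_den _ _]mulrA /moeb divfK // /moeb_den; ring.
Qed.

Lemma moeb1 z : moeb 1%g z = z.
Proof. by rewrite /moeb /moeb_den !SL2Z_1E /= mul1r addr0 mul0r add0r divr1. Qed.

End Moebius.

Section MoebiusSubstitution.
Variable R : realType.
Local Notation C := R[i].
Local Notation K := (Cxy R).
Implicit Types (M N : SL2Z) (p q : {poly C}) (z c : K).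

Definition linear_poly (a b : int) : {poly C} := a%:~R *: 'X + (b%:~R)%:P.

Lemma linear_poly_map (F : fieldType) (f : {rmorphism C -> F}) a b (z : F) :
  (map_poly f (linear_poly a b)).[z] = a%:~R * z + b%:~R.
Proof.
by rewrite rmorphD /= map_polyZ map_polyX map_polyC hornerD hornerZ hornerX
  hornerC /= !rmorph_int.
Qed.

Lemma size_linear_poly a b : (size (linear_poly a b) <= 2)%N.
Proof.
rewrite (leq_trans (size_polyD _ _)) // geq_max (leq_trans (size_scale_leq _ _)) ?size_polyX //.
by rewrite (leq_trans (size_polyC_leq1 _)).
Qed.

(** The homogenization of p in degree k, evaluated at the numerator and the
    denominator of the Moebius map. *)
Definition moeb_poly M k p : {poly C} := \sum_(i < k.+1)
  p`_i *: (linear_poly (M 0 0) (M 0 1) ^+ i * linear_poly (M 1 0) (M 1 1) ^+ (k - i)).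

(** Stated for a morphism f in order to apply both to points of C and to
    elements of C(x,y). *)
Lemma moeb_polyE (F : fieldType) (f : {rmorphism C -> F}) M k p (z : F) :
  (size p <= k.+1)%N -> moeb_den M z != 0 ->
  (map_poly f (moeb_poly M k p)).[z] =
  (map_poly f p).[moeb M z] * moeb_den M z ^+ k.
Proof.
move=> pk d0; rewrite rmorph_sum horner_sum.
rewrite (@horner_coef_wide _ k.+1) ?size_map_poly // mulr_suml.
apply: eq_bigr => i _; rewrite /= map_polyZ hornerZ coef_map -mulrA; congr (_ * _).
rewrite rmorphM hornerM !rmorphXn !horner_exp !linear_poly_map.
have -> : moeb_den M z ^+ k = moeb_den M z ^+ i * moeb_den M z ^+ (k - i).
  by rewrite -exprD subnKC // leq_ord.
rewrite -/(moeb_den M z) /moeb expr_div_n.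
by rewrite mulrA divfK // expf_neq0.
Qed.

Lemma size_moeb_poly M k p : (size (moeb_poly M k p) <= k.+1)%N.
Proof.
apply: leq_trans (size_sum _ _ _) _; apply/bigmax_leqP => i _.
apply: leq_trans (size_scale_leq _ _) _.
have sX (l : {poly C}) n : (size l <= 2)%N -> (size (l ^+ n) <= n.+1)%N.
  move=> l2; apply: leq_trans (size_poly_exp_leq _ _) _; rewrite ltnS.
  by rewrite -[leqRHS]mul1n leq_mul2r; case: (size l) l2 => [|[|[]]] //; rewrite orbT.
apply: leq_trans (size_polyMleq _ _) _.
have := sX _ i (size_linear_poly (M 0 0) (M 0 1)).
have := sX _ (k - i)%N (size_linear_poly (M 1 0) (M 1 1)).
by have := leq_ord i; lia.
Qed.

Lemma linear_poly_neq0 (a b : C) : (a, b) != (0, 0) -> a *: 'X + b%:P != 0.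
Proof.
apply: contraNneq => e; have := congr1 (fun p : {poly C} => (p`_1, p`_0)) e.
by rewrite !coef0 !coefD !coefZ !coefX !coefC /= !mulr0 mulr1 addr0 add0r => ->.
Qed.

Lemma moeb_den_neq0 M z : nonconstant z -> moeb_den M z != 0.
Proof.
move=> zc; rewrite /moeb_den -(linear_poly_map Kconst).
apply: poly_at_neq0 zc _; apply: linear_poly_neq0; apply/eqP => -[c0 d0].
by have := SL2Z_det_intr C M; rewrite c0 d0 !mulr0 subr0 => /eqP; rewrite eq_sym oner_eq0.
Qed.

Lemma moeb_nonconstant M z : nonconstant z -> nonconstant (moeb M z).
Proof.
move=> zc k; apply/eqP; have d0 := moeb_den_neq0 M zc.
have frac (F : fieldType) (u v l : F) : v != 0 -> u - l * v != 0 -> u / v != l.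
  by move=> v0; apply: contraNneq => <-; rewrite divfK // subrr.
apply: frac d0 _.
pose a := (M 0 0)%:~R - k * (M 1 0)%:~R; pose b := (M 0 1)%:~R - k * (M 1 1)%:~R.
have -> : (M 0 0)%:~R * z + (M 0 1)%:~R - Kconst k * moeb_den M z =
          poly_at z (a *: 'X + b%:P).
  rewrite rmorphD /= poly_atZ poly_atX poly_atC /a /b !rmorphB !rmorphM !rmorph_int.
  by rewrite /moeb_den; ring.
apply: poly_at_neq0 zc _; apply: linear_poly_neq0; apply/eqP => -[/eqP a0 /eqP b0].
move: a0 b0; rewrite !subr_eq0 => /eqP a0 /eqP b0.
have := SL2Z_det_intr C M; rewrite a0 b0 => /eqP.
by rewrite (_ : _ - _ = 0) ?(eq_sym 0) ?oner_eq0 //; ring.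
Qed.

Lemma poly2_atC p : poly2_at p%:P = poly_at Kx p.
Proof. by rewrite /poly2_at map_polyC hornerC. Qed.

Lemma poly2_atX : poly2_at 'X = Ky :> K.
Proof. by rewrite /poly2_at map_polyX hornerX. Qed.

Fact poly2_at_is_zmod_morphism : zmod_morphism (@poly2_at R).
Proof. by move=> p q; rewrite /poly2_at rmorphB hornerD hornerN. Qed.
HB.instance Definition _ :=
  GRing.isZmodMorphism.Build _ _ (@poly2_at R) poly2_at_is_zmod_morphism.

Fact poly2_at_is_monoid_morphism : monoid_morphism (@poly2_at R).
Proof. by split=> [|p q]; rewrite /poly2_at ?rmorph1 ?hornerC // rmorphM hornerM. Qed.
HB.instance Definition _ :=
  GRing.isMonoidMorphism.Build _ _ (@poly2_at R) poly2_at_is_monoid_morphism.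

Lemma Kx_nonconstant : nonconstant (Kx : K).
Proof.
move=> c e; have /polyC_inj X_c : 'X%:P = c%:P%:P :> {poly {poly C}}.
  by apply: poly2_at_inj; rewrite !poly2_atC poly_atX poly_atC.
by have := size_polyX C; rewrite X_c size_polyC; case: (c != 0).
Qed.

Lemma Ky_neq0 : Ky != 0 :> K.
Proof.
by rewrite -poly2_atX -(rmorph0 (@poly2_at R)) (inj_eq (@poly2_at_inj R)) polyX_eq0.
Qed.

End MoebiusSubstitution.

Section Degree.
Variable R : realType.
Local Notation C := R[i].
Local Notation K := (Cxy R).
Implicit Types (M N : SL2Z) (p q : {poly C}) (z c d : K).

(** c is a nonzero rational function of x of degree at most k; fractions need
    not be reduced, which makes the bounds on products immediate. *)
Definition degree_le k c : Prop := exists n m : {poly C},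
  [/\ n != 0, m != 0, (size n <= k.+1)%N, (size m <= k.+1)%N
    & c = poly_at Kx n / poly_at Kx m].

Lemma degree_le_neq0 k c : degree_le k c -> c != 0.
Proof.
case=> n [m [n0 m0 _ _ ->]].
by apply: mulf_neq0; rewrite ?invr_eq0 poly_at_neq0 //; exact: Kx_nonconstant.
Qed.

Lemma degree_le_const (a : C) : a != 0 -> degree_le 0 (Kconst a).
Proof.
move=> a0; exists a%:P, 1; split.
- by rewrite polyC_eq0.
- exact: oner_neq0.
- exact: size_polyC_leq1.
- by rewrite size_poly1.
- by rewrite poly_atC [poly_at _ 1]rmorph1 divr1.
Qed.

Lemma degree_le1 : degree_le 0 1.
Proof. by rewrite -(rmorph1 Kconst); apply: degree_le_const; exact: oner_neq0. Qed.

Lemma degree_leM k l c d : degree_le k c -> degree_le l d -> degree_le (k + l) (c * d).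
Proof.
case=> n [m [n0 m0 sn sm ->]] [n' [m' [n'0 m'0 sn' sm' ->]]].
exists (n * n'), (m * m'); split; try exact: mulf_neq0.
- by rewrite (leq_trans (size_polyMleq _ _)) //; lia.
- by rewrite (leq_trans (size_polyMleq _ _)) //; lia.
- by rewrite mulf_div !rmorphM.
Qed.

Lemma degree_leV k c : degree_le k c -> degree_le k c^-1.
Proof. by case=> n [m [n0 m0 sn sm ->]]; exists m, n; rewrite invf_div. Qed.

(** Clear denominators by [moeb_poly], in the common degree k. *)
Lemma degree_le_moeb (f : {rmorphism K -> K}) M k c :
  (forall a, f (Kconst a) = Kconst a) -> f Kx = moeb M Kx ->
  degree_le k c -> degree_le k (f c).
Proof.
move=> fC fx [n [m [n0 m0 sn sm ->]]].
have xc := @Kx_nonconstant R; have d0 := moeb_den_neq0 M xc.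
have sub p : (size p <= k.+1)%N ->
    poly_at Kx (moeb_poly M k p) = poly_at (moeb M Kx) p * moeb_den M Kx ^+ k.
  by move=> sp; apply: moeb_polyE.
have sub0 p : p != 0 -> (size p <= k.+1)%N -> moeb_poly M k p != 0.
  move=> p0 sp; apply/eqP => e; have := sub p sp.
  rewrite e [poly_at _ 0]rmorph0 => /esym/eqP; apply/negP; apply: mulf_neq0.
    exact: poly_at_neq0 (moeb_nonconstant xc) p0.
  exact: expf_neq0.
have cancel_den (F : fieldType) (a b e : F) : e != 0 -> a / b = (a * e) / (b * e).
  by move=> e0; rewrite -mulf_div divff ?mulr1.
exists (moeb_poly M k n), (moeb_poly M k m); split.
- exact: sub0.
- exact: sub0.
- exact: size_moeb_poly.
- exact: size_moeb_poly.
- rewrite (sub n sn) (sub m sm) fmorph_div !poly_at_fmorph // fx.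
  by apply: cancel_den; exact: expf_neq0.
Qed.

End Degree.

(** * Pullbacks and lifts of Moebius maps *)

Section Pullback.
Variable R : realType.
Local Notation C := R[i].
Local Notation K := (Cxy R).
Variables (f : K * K) (nf : nondeg f).

(** The proof that f is nondegenerate is an argument so that the morphism
    structures below can be attached to this function. *)
Definition pullback of nondeg f := fun r => pair_subst f r.
Local Notation pb := (pullback nf).

Let frac (r s : K) : exists n1 d1 n2 d2 : {mpoly C[2]},
  [/\ r = FracField.tofrac n1 / FracField.tofrac d1,
      s = FracField.tofrac n2 / FracField.tofrac d2, d1 != 0 & d2 != 0].
Proof.
exists \n_(repr r), \d_(repr r), \n_(repr s), \d_(repr s).
by split; [exact: frac_numden|exact: frac_numden| |]; exact: denom_ratioP.
Qed.

Lemma pullbackC a : pb (Kconst a) = Kconst a.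
Proof.
by rewrite /pullback [Kconst a]/(FracField.tofrac _) pair_subst_poly // meval_atC.
Qed.

Lemma pullbackX : pb Kx = f.1.
Proof. by rewrite /pullback pair_subst_poly // meval_atX (tnth_nth 0). Qed.

Lemma pullbackY : pb Ky = f.2.
Proof. by rewrite /pullback pair_subst_poly // meval_atX (tnth_nth 0). Qed.

Fact pullback_is_zmod_morphism : zmod_morphism pb.
Proof.
move=> r s; have [a [b [c [d [-> -> b0 d0]]]]] := frac r s.
have tb : FracField.tofrac b != 0 by rewrite tofrac_eq0.
have td : FracField.tofrac d != 0 by rewrite tofrac_eq0.
rewrite -mulNr (addf_div _ _ tb td) -!tofracN -!tofracM -tofracD /pullback.
rewrite !pair_subst_frac ?mulf_neq0 //.
rewrite -mulNr (addf_div _ _ (nf b0) (nf d0)).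
by rewrite rmorphD !rmorphM rmorphN.
Qed.
HB.instance Definition _ :=
  GRing.isZmodMorphism.Build _ _ pb pullback_is_zmod_morphism.

Fact pullback_is_monoid_morphism : monoid_morphism pb.
Proof.
split=> [|r s]; first by rewrite -(rmorph1 Kconst) pullbackC.
have [a [b [c [d [-> -> b0 d0]]]]] := frac r s.
rewrite mulf_div -!tofracM /pullback !pair_subst_frac ?mulf_neq0 //.
by rewrite !rmorphM mulf_div.
Qed.
HB.instance Definition _ :=
  GRing.isMonoidMorphism.Build _ _ pb pullback_is_monoid_morphism.

End Pullback.

Section Lifts.
Variable R : realType.
Local Notation C := R[i].
Local Notation K := (Cxy R).
Implicit Types (M N : SL2Z) (p q : {poly C}) (z c d : K).

(** The map (x, y) |-> (Mx, y c). *)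
Definition lift_map M c : K * K := (moeb M Kx, Ky * c).

Definition mpoly_of p : {mpoly C[2]} := (map_poly (@mpolyC 2 C) p).['X_0].

Lemma meval_at_mpoly_of (v : 2.-tuple K) p :
  meval_at v (mpoly_of p) = poly_at (tnth v 0) p.
Proof.
rewrite /mpoly_of -horner_map /= meval_atX -map_poly_comp; congr (_.[_]).
by apply: eq_map_poly => c; exact: meval_atC.
Qed.

Lemma tofrac_mpoly_of p : FracField.tofrac (mpoly_of p) = poly_at Kx p.
Proof. by rewrite -meval_id meval_at_mpoly_of (tnth_nth 0). Qed.

Lemma moeb_inv M z : nonconstant z -> moeb (M^-1)%g (moeb M z) = z.
Proof. by move=> zc; rewrite -moebM ?mulVg ?moeb1 //; exact: moeb_den_neq0. Qed.

(** The pair g below inverts the map on the coordinate functions, and this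
    already forces the kernel of the substitution to vanish. *)
Lemma nondeg_lift M k c : degree_le k c -> nondeg (lift_map M c).
Proof.
case=> n [m [n0 m0 _ _ cE]].
have xc := @Kx_nonconstant R.
pose w := moeb (M^-1)%g Kx : K.
have wc : nonconstant w by exact: moeb_nonconstant.
have Mw : moeb M w = Kx by rewrite -{1}[M]invgK moeb_inv.
pose g := (w, Ky * (poly_at w m / poly_at w n)) : K * K.
have inv i : exists a b, [/\ meval_at [tuple g.1; g.2] b != 0,
     meval_at [tuple (lift_map M c).1; (lift_map M c).2] 'X_i =
       FracField.tofrac a / FracField.tofrac b &
     FracField.tofrac 'X_i =
       meval_at [tuple g.1; g.2] a / meval_at [tuple g.1; g.2] b].
  rewrite meval_atX; case: i => [[|[|//]]] lt_i.
  - exists (mpoly_of (linear_poly _ (M 0 0) (M 0 1))).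
    exists (mpoly_of (linear_poly _ (M 1 0) (M 1 1))).
    rewrite !tofrac_mpoly_of !meval_at_mpoly_of !(tnth_nth 0) /=.
    have lin a b z : poly_at z (linear_poly R a b) = a%:~R * z + b%:~R.
      exact: linear_poly_map.
    rewrite !lin; split; [exact: (@moeb_den_neq0 R M w wc) | by [] |].
    transitivity (moeb M w); last by []; rewrite Mw /Kx.
    by congr (FracField.tofrac 'X_ _); apply: val_inj.
  - exists ('X_1 * mpoly_of n), (mpoly_of m).
    rewrite tofracM rmorphM /= !tofrac_mpoly_of !meval_at_mpoly_of meval_atX.
    rewrite !(tnth_nth 0) /=; split.
    + exact: poly_at_neq0.
    + by rewrite cE mulrA.
    + have eq_frac (F : fieldType) (y u v : F) : u != 0 -> v != 0 ->
        y = y * (v / u) * u / v.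
        by move=> u0 v0; field; rewrite u0 v0.
      rewrite -eq_frac; try exact: poly_at_neq0.
      by congr (FracField.tofrac 'X_ _); apply: val_inj.
move=> D; apply: contra_neq => D0.
have [a [b [b0 va ua]]] := rational_inverse (meval_atC _) (meval_atC _) inv D.
have nb : FracField.tofrac b != 0.
  by rewrite tofrac_eq0; apply: contraNneq b0 => ->; rewrite rmorph0.
move: (etrans (esym va) D0) => /eqP.
rewrite mulf_eq0 invr_eq0 (negbTE nb) orbF tofrac_eq0 => /eqP a0.
by apply/eqP; rewrite -tofrac_eq0 ua a0 rmorph0 mul0r.
Qed.

End Lifts.

Lemma moeb_fmorph (F G : fieldType) (f : {rmorphism F -> G}) M (z : F) :
  f (moeb M z) = moeb M (f z).
Proof. by rewrite /moeb /moeb_den fmorph_div !rmorphD !rmorphM !rmorph_int. Qed.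

Section BirLifts.
Variable R : realType.
Local Notation C := R[i].
Local Notation K := (Cxy R).
Implicit Types (M N : SL2Z) (z c d : K) (f g : Bir R).

Lemma degree_le_ext (u v : {rmorphism K -> K}) k c :
  (forall a, u (Kconst a) = Kconst a) -> (forall a, v (Kconst a) = Kconst a) ->
  u Kx = v Kx -> degree_le k c -> u c = v c.
Proof.
move=> uC vC uv [n [m [_ _ _ _ ->]]].
by rewrite !fmorph_div !poly_at_fmorph // uv.
Qed.

(** The inverse is (M^-1 x, y / c(M^-1 x)). *)
Lemma exists_lift M k c : degree_le k c -> exists f, bir_map f = lift_map M c.
Proof.
move=> ck; have xc := @Kx_nonconstant R.
pose n0 := @nondeg_lift R (M^-1)%g _ _ (degree_le1 R).
have n0C := pullbackC n0.
have n0x : pullback n0 Kx = moeb (M^-1)%g Kx by rewrite pullbackX.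
set c' := pullback n0 c.
have c'k : degree_le k c'^-1 by apply: degree_leV; apply: degree_le_moeb n0C n0x ck.
have n1 := @nondeg_lift R M _ _ ck; have n2 := @nondeg_lift R (M^-1)%g _ _ c'k.
have c0 := degree_le_neq0 ck; have c'0 := degree_le_neq0 c'k.
rewrite invr_eq0 in c'0.
have n2c : pullback n2 c = c'.
  apply: (@degree_le_ext (pullback n2) (pullback n0) k c) => //.
    exact: pullbackC.
  by rewrite /= n0x pullbackX.
have n1c' : pullback n1 c' = c.
  have e := @degree_le_ext (pullback n1 \o pullback n0) idfun k c.
  apply: e => // [a|]; first by rewrite /= n0C pullbackC.
  by rewrite /= n0x moeb_fmorph /= pullbackX moeb_inv.
have Mx : moeb M (moeb (M^-1)%g Kx) = Kx :> K by rewrite -{1}[M]invgK moeb_inv.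
have inv : mutual_inverse (lift_map M c, lift_map (M^-1)%g c'^-1).
  apply/andP; split; apply/eqP; congr (_, _).
  - by rewrite -[LHS]/(pullback n2 (moeb M Kx)) moeb_fmorph /= pullbackX Mx.
  - rewrite -[LHS]/(pullback n2 (Ky * c)) rmorphM /= pullbackY n2c.
    by rewrite (divfK c'0).
  - by rewrite -[LHS]/(pullback n1 (moeb _ Kx)) moeb_fmorph /= pullbackX moeb_inv.
  - rewrite -[LHS]/(pullback n1 (Ky * _)) rmorphM fmorphV /= pullbackY n1c'.
    by rewrite (mulfK c0).
by exists (MkBir inv).
Qed.

Definition bir_nondeg f : nondeg (bir_map f) :=
  mutual_inverse_nondeg (Bir_inv_subproof f).
Definition pull f : {rmorphism K -> K} := pullback (bir_nondeg f).

Lemma pullC f a : pull f (Kconst a) = Kconst a.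
Proof. exact: pullbackC. Qed.

Lemma pullX f M c : bir_map f = lift_map M c -> pull f Kx = moeb M Kx.
Proof. by move=> fE; rewrite [LHS]pullbackX fE. Qed.

Lemma pullY f M c : bir_map f = lift_map M c -> pull f Ky = Ky * c.
Proof. by move=> fE; rewrite [LHS]pullbackY fE. Qed.

Lemma bir_map_pull f g : bir_map (f * g)%g = (pull g (bir_map f).1, pull g (bir_map f).2).
Proof. by []. Qed.

(** The cocycle rule. *)
Lemma lift_mul f g M N c d :
  bir_map f = lift_map M c -> bir_map g = lift_map N d ->
  bir_map (f * g)%g = lift_map (M * N)%g (d * pull g c).
Proof.
move=> fE gE; rewrite bir_map_pull fE /=; congr (_, _).
  rewrite moeb_fmorph /= (pullX gE) moebM //.
  exact/moeb_den_neq0/Kx_nonconstant.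
by rewrite rmorphM (pullY gE) mulrA.
Qed.

End BirLifts.

(** * Degree of a map of the plane *)

Section TopComponent.
Variables (A : idomainType) (n : nat).
Implicit Types (F G H : {mpoly A[n]}).

Lemma pihomogM_top a b G H : (msize G <= a.+1)%N -> (msize H <= b.+1)%N ->
  pihomog mdeg (a + b) (G * H) = pihomog mdeg a G * pihomog mdeg b H.
Proof.
move=> Ga Hb; rewrite {1}(pihomog_partitionE Ga) {1}(pihomog_partitionE Hb).
have other i j : (i + j != a + b)%N ->
    pihomog mdeg (a + b) (pihomog mdeg i G * pihomog mdeg j H) = 0.
  by move=> ij; apply: pihomog_ne0 ij _; apply: dhomogM; exact: pihomogP.
rewrite mulr_suml raddf_sum (bigD1 ord_max) //= [X in _ + X]big1 ?addr0; last first.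
  move=> i /eqP ia; rewrite mulr_sumr raddf_sum big1 // => j _; apply: other.
  have i_a : nat_of_ord i != a by apply: contra_not_neq ia => e; apply: val_inj.
  by have := leq_ord i; have := leq_ord j; move: i_a; lia.
rewrite mulr_sumr raddf_sum (bigD1 ord_max) //= big1 ?addr0 => [|j /eqP jb].
  by rewrite pihomog_dE //; apply: dhomogM; exact: pihomogP.
apply: other; have j_b : nat_of_ord j != b by apply: contra_not_neq jb => e; apply: val_inj.
by rewrite eqn_add2l.
Qed.

(** The product of the top components is the component of F = G H in degree d,
    which is F. *)
Lemma homog_mul_top F G H d : G != 0 -> F \is d.-homog -> F = G * H ->
  F = pihomog mdeg (msize G).-1 G * pihomog mdeg (d - (msize G).-1) H.
Proof.
move=> G0 Fd FE; have [H0|H0] := eqVneq H 0.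
  by rewrite FE H0 mulr0 raddf0 mulr0.
have F0 : F != 0 by rewrite FE mulf_neq0.
have sF : msize F = d.+1.
  rewrite (mpolySpred _ F0); congr _.+1.
  exact: dhomog_uniq F0 (dhomog_msize Fd) Fd.
have sG_gt0 : (0 < msize G)%N by rewrite (mpolySpred _ G0).
have sH_gt0 : (0 < msize H)%N by rewrite (mpolySpred _ H0).
have := msizeM G0 H0; rewrite -FE sF => sz.
rewrite -pihomogM_top; [| |]; try by clear -sz sG_gt0 sH_gt0; lia.
have -> : ((msize G).-1 + (d - (msize G).-1) = d)%N by clear -sz sG_gt0 sH_gt0; lia.
by rewrite -FE pihomog_dE.
Qed.

Lemma msize_le1_unit (k : fieldType) (G : {mpoly k[n]}) :
  G != 0 -> (msize G <= 1)%N -> G \is a GRing.unit.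
Proof.
move=> G0 /msize1_polyC GE; apply/andP; split; first exact/eqP.
by rewrite unitfE; apply: contraNneq G0 => c0; rewrite GE c0 mpolyC0.
Qed.

End TopComponent.

Section ReducedTriple.
Variable R : realType.
Local Notation C := R[i].
Local Notation K := (Cxy R).
Local Notation ev := (meval_at [tuple Kx; Ky; 1]).

(** As [has_degree], with a possible common factor. *)
Definition has_presentation (f : Bir R) (d : nat) : Prop :=
  exists F0 F1 F2 : {mpoly C[3]},
    [/\ [/\ F0 \is d.-homog, F1 \is d.-homog & F2 \is d.-homog], ev F2 != 0 &
        bir_map f = (ev F0 / ev F2, ev F1 / ev F2)].

(** A common factor G of the three polynomials can be replaced by its
    top component and divided out, which lowers the degree. *)
Lemma has_degree_exists f d : has_presentation f d ->
  exists2 e, (e <= d)%N & has_degree f e.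
Proof.
have sub1 (x y z : nat) : (0 < y)%N -> z.+1 = (x + y).-1 -> (x.-1 <= z)%N by lia.
have sub2 (x z : nat) : (1 < x)%N -> (x.-1 <= z)%N -> (z - x.-1 < z)%N by lia.
have evM u v : ev (u * v) = ev u * ev v by exact: rmorphM.
have [n] := ubnP d; elim: n d => // n IH d dn [F0 [F1 [F2 [[h0 h1 h2] e2 fE]]]].
have [ncf|cf] := boolp.EM (no_common_factor F0 F1 F2).
  by exists d => //; exists F0, F1, F2.
have [G [H0 [H1 [H2 [E0 E1 E2 Gu]]]]] : exists G H0 H1 H2 : {mpoly C[3]},
    [/\ F0 = G * H0, F1 = G * H1, F2 = G * H2 & G \isn't a GRing.unit].
  apply: boolp.contrapT => no; apply: cf => G H0 H1 H2 E0 E1 E2.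
  by apply: boolp.contrapT => /negP Gu; apply: no; exists G, H0, H1, H2.
have F20 : F2 != 0 by apply: contraNneq e2 => ->; rewrite rmorph0.
have G0 : G != 0 by apply: contraNneq F20 => G0; rewrite E2 G0 mul0r.
have H20 : H2 != 0 by apply: contraNneq F20 => H20; rewrite E2 H20 mulr0.
have sG : (1 < msize G)%N.
  by rewrite ltnNge; apply: contra Gu => /(msize_le1_unit G0).
have sF : msize F2 = d.+1.
  rewrite (mpolySpred _ F20); congr _.+1.
  exact: dhomog_uniq F20 (dhomog_msize h2) h2.
have sGd : ((msize G).-1 <= d)%N.
  have sH_gt0 : (0 < msize H2)%N by rewrite (mpolySpred _ H20).
  have := msizeM G0 H20; rewrite -E2 sF => sz.
  exact: sub1 sH_gt0 sz.
move: (homog_mul_top G0 h0 E0) (homog_mul_top G0 h1 E1) (homog_mul_top G0 h2 E2).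
set e := (d - _)%N; set G' := pihomog _ _ G => T0 T1 T2.
have ed : (e < d)%N by exact: sub2 sG sGd.
have evT F H : F = G' * H -> ev F = ev G' * ev H by move=> ->; exact: evM.
have evG : ev G' != 0.
  by apply: contraNneq e2 => G'0; rewrite (evT _ _ T2) G'0 mul0r.
have [|e' e'e fe'] := IH e (leq_trans ed dn); last first.
  by exists e' => //; exact: leq_trans e'e (ltnW ed).
exists (pihomog mdeg e H0), (pihomog mdeg e H1), (pihomog mdeg e H2).
split; first by split; exact: pihomogP.
  by apply: contraNneq e2 => H'0; rewrite (evT _ _ T2) H'0 mulr0.
have cancel_factor (F : fieldType) (u v w : F) : u != 0 -> (u * v) / (u * w) = v / w.
  by move=> u0; rewrite -mulf_div divff ?mul1r.
rewrite fE (evT _ _ T0) (evT _ _ T1) (evT _ _ T2).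
by congr (_, _); exact: cancel_factor evG.
Qed.

End ReducedTriple.

Section DegreeComparison.
Variable R : realType.
Local Notation C := R[i].
Local Notation K := (Cxy R).
Local Notation ev := (@meval_at R 3 [tuple Kx; Ky; 1]).
Implicit Types (M N : SL2Z) (p q : {poly C}) (c : K) (f : Bir R).

Let evM u v : ev (u * v) = ev u * ev v. Proof. exact: rmorphM. Qed.
Let evD u v : ev (u + v) = ev u + ev v. Proof. exact: rmorphD. Qed.
Let evX0 : ev 'X_0 = Kx. Proof. by rewrite meval_atX (tnth_nth 0). Qed.
Let evX1 : ev 'X_1 = Ky. Proof. by rewrite meval_atX (tnth_nth 0). Qed.
Let evX2 : ev 'X_2 = 1. Proof. by rewrite meval_atX (tnth_nth 0). Qed.
Let evZ a u : ev (a *: u) = Kconst a * ev u.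
Proof. by rewrite -mul_mpolyC evM meval_atC. Qed.

Definition homogenize k p : {mpoly C[3]} :=
  \sum_(i < k.+1) p`_i *: ('X_0 ^+ i * 'X_2 ^+ (k - i)).

Lemma homogX1 (i : 'I_3) : ('X_i : {mpoly C[3]}) \is 1.-homog.
Proof. by rewrite dhomogX; apply/eqP; exact: mdeg1. Qed.

Lemma homogenize_homog k p : homogenize k p \is k.-homog.
Proof.
apply: rpred_sum => i _; apply: rpredZ.
have := dhomogM (dhomogMn i (homogX1 0)) (dhomogMn (k - i) (homogX1 2)).
by rewrite !mul1n subnKC // leq_ord.
Qed.

Lemma ev_homogenize k p : (size p <= k.+1)%N -> ev (homogenize k p) = poly_at Kx p.
Proof.
move=> pk; rewrite rmorph_sum /poly_at (@horner_coef_wide _ k.+1); last first.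
  by rewrite size_map_poly.
apply: eq_bigr => i _; rewrite coef_map /= evZ evM; congr (_ * _).
by rewrite !rmorphXn /= evX0 evX2 expr1n mulr1.
Qed.

(** Take (ax + b) m, y n (cx + d) and (cx + d) m for Mx = (ax + b)/(cx + d) and
    c = n/m, and homogenize them in degree k + 2. *)
Lemma degree_upper f M k c : bir_map f = lift_map M c -> degree_le k c ->
  exists2 e, (e <= k.+2)%N & has_degree f e.
Proof.
move=> fE [n [m [n0 m0 sn sm cE]]]; apply: has_degree_exists.
pose lin (a b : int) : {mpoly C[3]} := (a%:~R : C) *: 'X_0 + (b%:~R : C) *: 'X_2.
have lin_homog a b : lin a b \is 1.-homog.
  by apply: rpredD; apply: rpredZ; exact: homogX1.
have ev_lin a b : ev (lin a b) = a%:~R * Kx + b%:~R.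
  by rewrite /lin evD !evZ evX0 evX2 mulr1 !rmorph_int.
have d0 : moeb_den M Kx != 0 :> K by exact/moeb_den_neq0/Kx_nonconstant.
have mx0 : poly_at Kx m != 0 by exact/poly_at_neq0/m0/Kx_nonconstant.
have ev3 u v w : ev (u * v * w) = ev u * ev v * ev w by rewrite (evM (u * v)) evM.
have deg (u v w : {mpoly C[3]}) : u \is 1.-homog -> v \is k.-homog -> w \is 1.-homog ->
    u * v * w \is k.+2.-homog.
  by move=> hu hv hw; have := dhomogM (dhomogM hu hv) hw; rewrite addn1.
have [G0 h0 e0] : exists2 G, G \is k.+2.-homog &
    ev G = ((M 0 0)%:~R * Kx + (M 0 1)%:~R) * poly_at Kx m.
  exists (lin (M 0 0) (M 0 1) * homogenize k m * 'X_2).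
    by apply: deg; rewrite ?homogenize_homog ?homogX1 ?lin_homog.
  by rewrite ev3 ev_lin ev_homogenize // evX2 mulr1.
have [G1 h1 e1] : exists2 G, G \is k.+2.-homog &
    ev G = Ky * poly_at Kx n * moeb_den M Kx.
  exists ('X_1 * homogenize k n * lin (M 1 0) (M 1 1)).
    by apply: deg; rewrite ?homogenize_homog ?homogX1 ?lin_homog.
  by rewrite ev3 ev_lin ev_homogenize // evX1.
have [G2 h2 e2] : exists2 G, G \is k.+2.-homog &
    ev G = moeb_den M Kx * poly_at Kx m.
  exists (lin (M 1 0) (M 1 1) * homogenize k m * 'X_2).
    by apply: deg; rewrite ?homogenize_homog ?homogX1 ?lin_homog.
  by rewrite ev3 ev_lin ev_homogenize // evX2 mulr1.
exists G0, G1, G2; split; first by [].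
- by rewrite e2; exact: (mulf_neq0 d0 mx0).
- rewrite fE e2 e0 e1; congr (_, _).
    have frac (F : fieldType) (a b e : F) : e != 0 -> a / b = a * e / (b * e).
      by move=> en0; rewrite -mulf_div divff // mulr1.
    exact: (frac _ _ _ _ mx0).
  rewrite cE; have frac (F : fieldType) (y a b e : F) : e != 0 -> b != 0 ->
      y * (a / b) = y * a * e / (e * b).
    by move=> en0 b0; field; rewrite en0 b0.
  exact: (frac _ _ _ _ _ d0 mx0).
Qed.

Definition dehomogenize (F : {mpoly C[3]}) : {poly {poly C}} :=
  mmap (polyC \o polyC) (nth 0 [:: 'X%:P; 'X; 1]) F.

Lemma ev_dehomogenize F : ev F = poly2_at (dehomogenize F).
Proof.
rewrite meval_atE /dehomogenize /mmap rmorph_sum; apply: eq_bigr => m _ /=.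
rewrite rmorphM /= poly2_atC poly_atC; congr (_ * _); rewrite /mmap1 rmorph_prod.
apply: eq_bigr => i _; rewrite rmorphXn /=; congr (_ ^+ _).
rewrite (tnth_nth 0); case: i => [[|[|[|//]]]] /= _.
- by rewrite poly2_atC poly_atX.
- by rewrite poly2_atX.
- by rewrite [RHS]rmorph1.
Qed.

Lemma size_dehomogenize d F j : F \is d.-homog ->
  (size ((dehomogenize F)`_j)%R <= d.+1)%N.
Proof.
move=> /dhomogP Fd; rewrite /dehomogenize /mmap coef_sum.
rewrite big_seq; apply: (big_ind (fun p : {poly C} => size p <= d.+1)%N) => [|p q sp sq|m mF].
- by rewrite size_poly0.
- by rewrite (leq_trans (size_polyD _ _)) // geq_max sp.
have -> : mmap1 (nth 0 [:: 'X%:P; 'X; 1]) m =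
    ('X ^+ m ord0)%:P * 'X^(m (lift ord0 ord0)) :> {poly {poly C}}.
  rewrite /mmap1 !big_ord_recl big_ord0 mulr1 [X in _ * (_ * X)]expr1n mulr1.
  by rewrite rmorphXn.
have cE (a : C) (u : {poly C}) l : ((polyC \o polyC) a * (u%:P * 'X^l))`_j =
    a *: (u *+ (j == l)).
  rewrite [(polyC \o polyC) a]/(a%:P%:P) mulrA -polyCM coefCM coefXn.
  by rewrite mulr_natr mul_polyC scalerMnr.
rewrite cE (leq_trans (size_scale_leq _ _)) //.
have m0d : (m ord0 <= d)%N.
  have <- : mdeg m = d by exact: Fd.
  by rewrite mdegE (bigD1 ord0) //= leq_addr.
by case: (j == _); rewrite ?mulr1n ?mulr0n ?size_poly0 // size_polyXn.
Qed.

(** If F1/F2 = y c on the chart z = 1, then c is the quotient of the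
    coefficients of y^(j+1) in F1 and of y^j in F2, polynomials in x of degree
    at most d. *)
Lemma degree_lower f M k c d : bir_map f = lift_map M c -> degree_le k c ->
  has_degree f d -> degree_le d c.
Proof.
move=> fE [n [m [n0 m0 _ _ cE]]] [F0 [F1 [F2 [[_ h1 h2] _ e2]]]].
rewrite fE => -[_ /esym].
have mx0 : poly_at Kx m != 0 by exact/poly_at_neq0/m0/Kx_nonconstant.
have cross (F : fieldType) (u v y a b : F) : v != 0 -> b != 0 ->
    u / v = y * (a / b) -> u * b = y * a * v.
  by move=> v0 b0 /(canRL (divfK v0)) ->; field.
rewrite cE => /(cross _ _ _ _ _ _ e2 mx0); rewrite !ev_dehomogenize.
rewrite -!poly2_atC -poly2_atX -!rmorphM /= => /(@poly2_at_inj R).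
move: e2; rewrite ev_dehomogenize => e2.
have G2 : dehomogenize F2 != 0 by apply: contraNneq e2 => ->; rewrite rmorph0.
have s1 j : (size (((dehomogenize F1)`_j)%R : {poly C}) <= d.+1)%N.
  exact: size_dehomogenize.
have s2 j : (size (((dehomogenize F2)`_j)%R : {poly C}) <= d.+1)%N.
  exact: size_dehomogenize.
move: s1 s2 G2.
move: (dehomogenize F1) (dehomogenize F2) => G1 G2 s1 s2 G20 eG.
pose j := (size G2).-1.
have q0 : G2`_j != 0 by rewrite -[G2`_j]/(lead_coef G2) lead_coef_eq0.
have pq : G1`_j.+1 * m = n * G2`_j.
  have := congr1 (fun G : {poly {poly C}} => G`_j.+1) eG.
  by rewrite coefMC -mulrA coefXM /= coefCM.
exists G1`_j.+1, G2`_j; split=> //.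
  by apply: contraNneq (mulf_neq0 n0 q0) => p0; rewrite -pq p0 mul0r.
have q0' : poly_at Kx G2`_j != 0 by exact/poly_at_neq0/q0/Kx_nonconstant.
have cross' (F : fieldType) (u v a b : F) : v != 0 -> b != 0 ->
    u * b = a * v -> a / b = u / v.
  by move=> v0 b0 e; apply/eqP; rewrite eqr_div // e.
have := congr1 (poly_at Kx) pq; rewrite !rmorphM /= => pq'; rewrite !poly2_atC.
exact: (cross' _ _ _ _ _ q0' mx0 pq').
Qed.

End DegreeComparison.

(** * Orders of vanishing *)

Section UniSubst.
Variable R : realType.
Local Notation C := R[i].
Local Notation K := (Cxy R).
Variables (z : K) (zc : nonconstant z).

(** As for [pullback], the proof argument carries the morphism structures. *)
Definition usubst of nonconstant z := fun P : {fraction {poly C}} => uni_subst P z.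
Local Notation us := (usubst zc).

Lemma usubst_frac n d : d != 0 ->
  us (FracField.tofrac n / FracField.tofrac d) = poly_at z n / poly_at z d.
Proof.
move=> d0; rewrite /usubst uni_subst.unlock.
set r := FracField.tofrac n / _; set a := \n_(repr r); set b := \d_(repr r).
have b0 : b != 0 by exact: denom_ratioP.
have /eqP := frac_numden r; rewrite -/a -/b /r.
rewrite eqr_div ?tofrac_eq0 // -!tofracM tofrac_eq => /eqP/esym E.
have := congr1 (poly_at z) E; rewrite !rmorphM /= => E'.
apply/eqP; rewrite -/(poly_at z a) -/(poly_at z b) eqr_div ?E' //.
  exact: poly_at_neq0.
exact: poly_at_neq0.
Qed.

Let frac (r s : {fraction {poly C}}) : exists n1 d1 n2 d2 : {poly C},
  [/\ r = FracField.tofrac n1 / FracField.tofrac d1,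
      s = FracField.tofrac n2 / FracField.tofrac d2, d1 != 0 & d2 != 0].
Proof.
exists \n_(repr r), \d_(repr r), \n_(repr s), \d_(repr s).
by split; [exact: frac_numden|exact: frac_numden| |]; exact: denom_ratioP.
Qed.

Lemma usubst_poly n : us (FracField.tofrac n) = poly_at z n.
Proof.
rewrite -[FracField.tofrac n]divr1 -[X in _ / X]tofrac1 usubst_frac ?oner_neq0 //.
by rewrite [poly_at z 1]rmorph1 divr1.
Qed.

Fact usubst_is_zmod_morphism : zmod_morphism us.
Proof.
move=> r s; have [a [b [c [d [-> -> b0 d0]]]]] := frac r s.
have tb : FracField.tofrac b != 0 by rewrite tofrac_eq0.
have td : FracField.tofrac d != 0 by rewrite tofrac_eq0.
have pb := poly_at_neq0 zc b0; have pd := poly_at_neq0 zc d0.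
rewrite -mulNr (addf_div _ _ tb td) -!tofracN -!tofracM -tofracD.
rewrite (usubst_frac _ (mulf_neq0 b0 d0)) (usubst_frac _ b0) (usubst_frac _ d0).
rewrite -[X in _ = _ + X]mulNr (addf_div _ _ pb pd).
by rewrite rmorphD !rmorphM rmorphN.
Qed.
HB.instance Definition _ :=
  GRing.isZmodMorphism.Build _ _ us usubst_is_zmod_morphism.

Fact usubst_is_monoid_morphism : monoid_morphism us.
Proof.
split=> [|r s]; first by rewrite -tofrac1 usubst_poly rmorph1.
have [a [b [c [d [-> -> b0 d0]]]]] := frac r s.
rewrite mulf_div -!tofracM (usubst_frac _ (mulf_neq0 b0 d0)).
by rewrite (usubst_frac _ b0) (usubst_frac _ d0) !rmorphM mulf_div.
Qed.
HB.instance Definition _ :=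
  GRing.isMonoidMorphism.Build _ _ us usubst_is_monoid_morphism.

End UniSubst.

Section UniSubstPull.
Variable R : realType.
Local Notation C := R[i].
Local Notation K := (Cxy R).

Lemma uni_subst_fmorph (f : {rmorphism K -> K}) P z :
  (forall a, f (Kconst a) = Kconst a) -> f (uni_subst P z) = uni_subst P (f z).
Proof.
move=> fC; rewrite uni_subst.unlock -/(poly_at _ _) fmorph_div.
by rewrite -!/(poly_at z _) !poly_at_fmorph.
Qed.

Lemma uni_subst_neq0 P (z : K) : nonconstant z -> P != 0 -> uni_subst P z != 0.
Proof. by move=> zc P0; rewrite -[uni_subst P z]/(usubst zc P) fmorph_eq0. Qed.

Lemma degree_le_uni_subst P : P != 0 -> exists k, degree_le k (uni_subst P (Kx : K)).
Proof.
move=> P0; have xc := @Kx_nonconstant R.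
have d0 : \d_(repr P) != 0 by exact: denom_ratioP.
have n0 : \n_(repr P) != 0.
  by apply: contraNneq P0 => n0; rewrite (frac_numden P) n0 tofrac0 mul0r.
exists (maxn (size \n_(repr P)) (size \d_(repr P))), \n_(repr P), \d_(repr P).
split=> //; try by rewrite leqW // ?leq_maxl ?leq_maxr.
by rewrite uni_subst.unlock.
Qed.

End UniSubstPull.

Section Order.
Variable R : realType.
Local Notation C := R[i].
Local Notation K := (Cxy R).
Implicit Types (p : C) (c : K) (k l : int).

(** [has_order], for elements of C(x,y) that are rational functions of x. *)
Definition order_at p k c : Prop := exists n d : {poly C},
  [/\ n.[p] != 0, d.[p] != 0 &
      c = (Kx - Kconst p) ^ k * (poly_at Kx n / poly_at Kx d)].

Lemma horner_neq0 p (n : {poly C}) : n.[p] != 0 -> n != 0.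
Proof. by apply: contraNneq => ->; rewrite horner0. Qed.

Lemma poly_at_inj (z : K) : nonconstant z -> injective (poly_at z).
Proof.
move=> zc n m e; apply/eqP; rewrite -subr_eq0; apply: contraT => /(poly_at_neq0 zc).
by rewrite rmorphB /= e subrr eqxx.
Qed.

Lemma poly_atXsubC (z : K) p : poly_at z ('X - p%:P) = z - Kconst p.
Proof. by rewrite (raddfB (poly_at z)) /= poly_atX poly_atC. Qed.

Lemma Kx_sub_neq0 p : Kx - Kconst p != 0 :> K.
Proof. by rewrite subr_eq0; apply/eqP/Kx_nonconstant. Qed.

Lemma order_at_poly p (n : {poly C}) : n.[p] != 0 -> order_at p 0 (poly_at Kx n).
Proof.
move=> np; exists n, 1; split=> //; first by rewrite hornerC oner_neq0.
by rewrite expr0z mul1r [poly_at Kx 1]rmorph1 divr1.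
Qed.

Lemma order_atM p k l c c' :
  order_at p k c -> order_at p l c' -> order_at p (k + l) (c * c').
Proof.
move=> [n [d [n0 d0 ->]]] [n' [d' [n'0 d'0 ->]]].
exists (n * n'), (d * d'); split.
- by rewrite hornerM mulf_neq0.
- by rewrite hornerM mulf_neq0.
- by rewrite mulrACA mulf_div !rmorphM -expfzDr // Kx_sub_neq0.
Qed.

Lemma order_atV p k c : order_at p k c -> order_at p (- k) c^-1.
Proof.
by move=> [n [d [n0 d0 ->]]]; exists d, n; split=> //; rewrite invfM invf_div invr_expz.
Qed.

Lemma order_atX p k c l : order_at p k c -> order_at p (k * l) (c ^ l).
Proof.
move=> ck; have nat j : order_at p (k * j%:Z) (c ^+ j).
  elim: j => [|j IH].
    rewrite expr0 mulr0 -(rmorph1 (poly_at Kx)); apply: order_at_poly.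
    by rewrite hornerC oner_neq0.
  by rewrite exprS -addn1 addnC PoszD mulrDr mulr1; exact: order_atM ck IH.
case: l => j; first exact: nat.
by rewrite NegzE mulrN -exprnN; exact/order_atV/nat.
Qed.

Lemma order_at_Kx p : order_at p 1 (Kx - Kconst p).
Proof.
exists 1, 1; rewrite !hornerC oner_neq0; split=> //.
by rewrite [poly_at Kx 1]rmorph1 divr1 mulr1 expr1z.
Qed.

Lemma order_at_const p (a : C) : a != 0 -> order_at p 0 (Kconst a).
Proof. by move=> a0; rewrite -(poly_atC Kx a); apply: order_at_poly; rewrite hornerC. Qed.

(** Mx - Mp = (x - p) / (j(x) j(p)), where j is the denominator of the Moebius map:
    a Moebius map is a local isomorphism at p. *)
Lemma order_at_moeb (f : {rmorphism K -> K}) M p k c :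
  (forall a, f (Kconst a) = Kconst a) -> f Kx = moeb M Kx ->
  moeb_den M p != 0 -> order_at (moeb M p) k c -> order_at p k (f c).
Proof.
move=> fC fx d0 [n [d [n0 dn0 ->]]].
have xc := @Kx_nonconstant R; have D0 := moeb_den_neq0 M xc.
have den0 : order_at p 0 (moeb_den M Kx).
  rewrite /moeb_den -(linear_poly_map Kconst); apply: order_at_poly.
  have := linear_poly_map idfun (M 1 0) (M 1 1) p; rewrite map_poly_id // => ->.
  exact: d0.
have poly0 (u : {poly C}) : u.[moeb M p] != 0 -> order_at p 0 (poly_at (moeb M Kx) u).
  move=> u0.
  have eK := moeb_polyE (M := M) Kconst (leqnSn (size u)) D0.
  have eC := moeb_polyE (M := M) idfun (leqnSn (size u)) d0.
  have -> : poly_at (moeb M Kx) u =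
      poly_at Kx (moeb_poly M (size u) u) * (moeb_den M Kx ^ (size u))^-1.
    by apply: (canRL (mulfK _)); [exact: expf_neq0 | exact: esym eK].
  rewrite -[0]addr0; apply: order_atM.
    apply: order_at_poly; rewrite !map_poly_id // in eC; rewrite eC.
    by apply: mulf_neq0 => //; exact: expf_neq0.
  by rewrite -oppr0; apply: order_atV; rewrite -[0](mul0r (size u)%:Z); exact: order_atX.
have x1 : order_at p 1 (moeb M Kx - Kconst (moeb M p)).
  have diff (F : fieldType) (x y : F) : moeb_den M x != 0 -> moeb_den M y != 0 ->
      moeb M x - moeb M y = (x - y) * (moeb_den M x)^-1 * (moeb_den M y)^-1.
    have := SL2Z_det_intr F M; rewrite /moeb /moeb_den.
    move: (M 0 0)%:~R (M 0 1)%:~R (M 1 0)%:~R (M 1 1)%:~R => a b c' e det x0 y0.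
    rewrite -[x - y]mul1r -det; field; by rewrite x0 y0.
  have denC : moeb_den M (Kconst p) = Kconst (moeb_den M p).
    by rewrite /moeb_den rmorphD rmorphM !rmorph_int.
  rewrite moeb_fmorph diff ?denC ?fmorph_eq0 //.
  rewrite -[1]addr0 -[1]addr0; apply: order_atM; first apply: order_atM.
  - exact: order_at_Kx.
  - by rewrite -oppr0; exact: order_atV.
  - by rewrite -oppr0; apply: order_atV; exact: order_at_const.
rewrite rmorphM fmorphXz rmorphB fC fx [f (_ / _)]fmorph_div /= !poly_at_fmorph // fx.
have xk := order_atX k x1; rewrite mul1r in xk.
have := order_atM xk (order_atM (poly0 n n0) (order_atV (poly0 d dn0))).
by rewrite oppr0 !addr0.
Qed.

Lemma order_at_root p c (n m : {poly C}) : order_at p 1 c ->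
  m != 0 -> c = poly_at Kx n / poly_at Kx m -> root n p.
Proof.
move=> [u [v [_ v0 ->]]] m0 e; have xc := @Kx_nonconstant R.
have pm := poly_at_neq0 xc m0; have pv := poly_at_neq0 xc (horner_neq0 v0).
have cross (F : fieldType) (x a b a' b' : F) : b != 0 -> b' != 0 ->
    x ^ 1 * (a / b) = a' / b' -> a' * b = x * a * b'.
  by rewrite expr1z => b0 b'0 eq; rewrite -[a'](divfK b'0) -eq; field.
have := cross _ _ _ _ _ _ pv pm e.
rewrite -poly_atXsubC -!rmorphM /= => /(poly_at_inj xc)/(congr1 (horner^~ p)).
rewrite /= !hornerM hornerXsubC subrr !mul0r => /eqP.
by rewrite mulf_eq0 (negbTE v0) orbF.
Qed.

Lemma has_order_at P a k : has_order P a k -> order_at a k (uni_subst P Kx).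
Proof.
move=> [n [d [n0 d0 ->]]]; exists n, d; split=> //.
have xc := @Kx_nonconstant R; rewrite -[LHS]/(usubst xc _).
rewrite rmorphM fmorphXz /= (usubst_poly xc) (usubst_frac xc _ (horner_neq0 d0)).
by rewrite poly_atXsubC.
Qed.

Lemma has_order_exists (P : {fraction {poly C}}) a : P != 0 -> exists k, has_order P a k.
Proof.
move=> P0.
have d0 : \d_(repr P) != 0 by exact: denom_ratioP.
have n0 : \n_(repr P) != 0.
  by apply: contraNneq P0 => n0; rewrite (frac_numden P) n0 tofrac0 mul0r.
have [i [n na nE]] := multiplicity_XsubC \n_(repr P) a.
have [j [d da dE]] := multiplicity_XsubC \d_(repr P) a.
exists (i%:Z - j%:Z), n, d; split.
- by move: na; rewrite n0.
- by move: da; rewrite d0.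
- have X0 : FracField.tofrac ('X - a%:P) != 0 by rewrite tofrac_eq0 polyXsubC_eq0.
  rewrite {1}(frac_numden P) nE dE !tofracM !rmorphXn expfzDr //.
  by rewrite -mulf_div mulrC -exprnN.
Qed.

End Order.

(** * Orbits without isotropy *)

Lemma pm1V M : pm1 (M^-1)%g -> pm1 M.
Proof.
case=> e; [left|right]; apply: invg_inj; rewrite e ?invg1 //.
by apply/esym/mulg1_eq; rewrite -expgnDr matS4.
Qed.

Lemma matSV : (matS^-1 = matS ^+ 3)%g.
Proof. by apply: mulg1_eq; rewrite -expgS matS4. Qed.

Lemma matS_word_pm1 w : ~ pm1 (matS * wordSA w)%g.
Proof.
case=> e; have := mulKg matS (wordSA w); rewrite e.
  by rewrite mulg1 matSV => /esym; exact: (@word_S w 1).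
by rewrite expg2 mulKg -[matS]expg1 => /esym; exact: (@word_S w 0).
Qed.

Lemma matS_wordV_pm1 w : ~ pm1 (matS * (wordSA w)^-1)%g.
Proof.
case=> e; have := mulgVK (wordSA w) matS; rewrite e.
  by rewrite mul1g -[matS]expg1; exact: (@word_S w 0).
move=> e2; apply: (@word_S w 1).
rewrite -[LHS]mul1g -matS4 -[(matS ^+ 1.*2.+1)%g]mulg1 (expgnDr _ 2 2) -mulgA e2.
by rewrite mulg1 -expgSr.
Qed.

Section Orbit.
Variable R : realType.
Local Notation C := R[i].
Variables (a : C) (a_free : no_isotropy (Some a)).
Implicit Types M N : SL2Z.

(** If M sent a to infinity, then M^-1 R M would fix a, as R fixes infinity. *)
Lemma orbit_den_neq0 M : moeb_den M a != 0.
Proof.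
apply/eqP => d0; pose N : SL2Z := (M^-1 * matR * M)%g.
have [i00 i01 i10 i11] := SL2Z_invE M.
have N0 j : N 0 j = (M 1 1 * (M 0 j + M 1 j) - M 0 1 * M 1 j).
  by rewrite /N -mulgA !SL2Z_mulE !matRE i00 i01 /=; ring.
have N1 j : N 1 j = (- M 1 0 * (M 0 j + M 1 j) + M 0 0 * M 1 j).
  by rewrite /N -mulgA !SL2Z_mulE !matRE i10 i11 /=; ring.
have det := SL2Z_detE M.
have e00 : N 0 0 = 1 + M 1 1 * M 1 0 by rewrite N0 -det; ring.
have e01 : N 0 1 = M 1 1 * M 1 1 by rewrite N0; ring.
have e10 : N 1 0 = - M 1 0 * M 1 0 by rewrite N1; ring.
have e11 : N 1 1 = 1 - M 1 0 * M 1 1 by rewrite N1 -det; ring.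
have fixN : mobius N (Some a) = Some a.
  rewrite /mobius e00 e01 e10 e11.
  have -> : (- M 1 0 * M 1 0)%:~R * a + (1 - M 1 0 * M 1 1)%:~R = 1 :> C.
    rewrite rmorphM rmorphN rmorphB rmorphM rmorph1 /=.
    rewrite (_ : _ + _ = 1 - (M 1 0)%:~R * moeb_den M a); last by rewrite /moeb_den; ring.
    by rewrite d0 mulr0 subr0.
  rewrite oner_eq0 divr1; congr Some.
  rewrite rmorphD !rmorphM rmorph1 /=.
  rewrite (_ : _ + _ = a + (M 1 1)%:~R * moeb_den M a); last by rewrite /moeb_den; ring.
  by rewrite d0 mulr0 addr0.
have : N 1 0 = 0 /\ N 0 1 = 0.
  by case: (a_free fixN) => ->; rewrite !mxE.
rewrite e10 e01 => -[c0 dd0].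
have c0' : M 1 0 = 0 by apply/eqP; move/eqP: c0; rewrite mulNr oppr_eq0 mulf_eq0 orbb.
have d0' : M 1 1 = 0 by apply/eqP; move/eqP: dd0; rewrite mulf_eq0 orbb.
by move: det; rewrite c0' d0' !mulr0 subr0.
Qed.

Lemma orbitM M N : moeb (M * N)%g a = moeb M (moeb N a).
Proof. exact: moebM (orbit_den_neq0 N). Qed.

Lemma orbit_denM M N : moeb_den M (moeb N a) != 0.
Proof.
have := orbit_den_neq0 (M * N)%g.
by rewrite moeb_denM ?orbit_den_neq0 // mulf_eq0 negb_or => /andP[].
Qed.

Lemma mobius_orbit M : mobius M (Some a) = Some (moeb M a).
Proof. by rewrite /mobius -/(moeb_den M a) (negbTE (orbit_den_neq0 M)). Qed.

Lemma orbit_fix M : moeb M a = a -> pm1 M.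
Proof. by move=> Ma; apply: pm1P; apply: a_free; rewrite mobius_orbit Ma. Qed.

Lemma orbit_inj M N : moeb M a = moeb N a -> pm1 (N^-1 * M)%g.
Proof. by move=> MN; apply: orbit_fix; rewrite orbitM MN -orbitM mulVg moeb1. Qed.

End Orbit.

(** * The cocycle and its zeros *)

Lemma multiplicative1 (G H : groupType) (f : {multiplicative G -> H}) : f 1%g = 1%g.
Proof. by apply: (@mulgI _ (f 1%g)); rewrite mulg1 -gmulfM mulg1. Qed.

Lemma multiplicativeX (G H : groupType) (f : {multiplicative G -> H}) x n :
  f (x ^+ n)%g = (f x ^+ n)%g.
Proof.
by elim: n => [|n IH]; rewrite ?multiplicative1 // !expgS gmulfM IH.
Qed.

Section Cocycle.
Variable R : realType.
Local Notation C := R[i].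
Local Notation K := (Cxy R).
Variables (P : {fraction {poly C}}) (P0 : P != 0).
Local Notation Psub M := (uni_subst P (moeb M Kx : K)).

Lemma pull_uni_subst (f : Bir R) M N c :
  bir_map f = lift_map N c -> pull f (Psub M) = Psub (M * N)%g.
Proof.
move=> fE; rewrite (uni_subst_fmorph _ _ (@pullC R _)) moeb_fmorph (pullX fE).
by rewrite -moebM //; apply: moeb_den_neq0; exact: Kx_nonconstant.
Qed.

Lemma Psub_neq0 M : Psub M != 0.
Proof. by apply: uni_subst_neq0 P0; apply: moeb_nonconstant; exact: Kx_nonconstant. Qed.

Lemma coboundary_chain (F : fieldType) (u v w : F) : u != 0 -> (u / v) * (w / u) = w / v.
Proof. by move=> u0; rewrite mulrC mulrA divfK. Qed.

Lemma i_neq0 : 'i%C != 0 :> C.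
Proof. by rewrite eq_complex /= oner_eq0 andbF. Qed.

Lemma degree_le_Psub M : exists k, degree_le k (Psub M).
Proof.
have [k Pk] := degree_le_uni_subst P0.
have [f fE] := exists_lift M (degree_le1 R).
exists k; have := degree_le_moeb (@pullC R f) (pullX fE) Pk.
by rewrite (uni_subst_fmorph _ _ (@pullC R f)) (pullX fE).
Qed.

Lemma degree_le_coboundary M N : exists k, degree_le k (Psub M / Psub N).
Proof.
have [k Mk] := degree_le_Psub M; have [l Nl] := degree_le_Psub N.
by exists (k + l)%N; apply: degree_leM Mk (degree_leV Nl).
Qed.

(** In each relation the contributions of P form a telescoping product. *)
Lemma exists_theta : exists theta : {multiplicative SL2Z -> Bir R},
  bir_map (theta matS) = lift_map matS (Kconst 'i%C) /\
  bir_map (theta matA) = lift_map matA (Psub matA / Psub 1%g).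
Proof.
have [s sE] := exists_lift matS (degree_le_const i_neq0).
have [k Ak] := degree_le_coboundary matA 1%g.
have [a aE] := exists_lift matA Ak.
have s2E : bir_map (s ^+ 2)%g = lift_map (matS ^+ 2)%g (Kconst (-1)).
  rewrite expg2 (lift_mul sE sE) pullC -rmorphM; congr (lift_map _ (Kconst _)).
  by rewrite -expr2 sqr_i.
have a2E : bir_map (a ^+ 2)%g = lift_map (matA ^+ 2)%g (Psub (matA ^+ 2)%g / Psub 1%g).
  rewrite expg2 (lift_mul aE aE) fmorph_div !(pull_uni_subst _ aE) mul1g.
  by rewrite coboundary_chain ?Psub_neq0.
have one : bir_map (1%g : Bir R) = lift_map 1%g 1 by rewrite /lift_map moeb1 mulr1.
have s4 : (s ^+ 4 = 1)%g.
  apply: bir_map_inj; rewrite (expgnDr _ 2 2) (lift_mul s2E s2E) pullC -rmorphM mulN1r opprK.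
  by rewrite rmorph1 -expgnDr matS4 one.
have a3 : (a ^+ 3 = 1)%g.
  apply: bir_map_inj; rewrite expgS (lift_mul aE a2E) fmorph_div !(pull_uni_subst _ a2E).
  by rewrite mul1g -expgS matA3 coboundary_chain ?Psub_neq0 // divff ?Psub_neq0 // one.
have s2a : commute (s ^+ 2)%g a.
  apply: bir_map_inj; rewrite (lift_mul s2E aE) (lift_mul aE s2E) matS2A; congr lift_map.
  rewrite pullC mulrC; congr (_ * _).
  have x2 : pull (s ^+ 2)%g Kx = Kx.
    rewrite (pullX s2E) /moeb /moeb_den !matS2E1 /=.
    by rewrite !(oppr0, mul0r, addr0, add0r) mulN1r invrN1 mulrN1 opprK.
  exact/esym/(@degree_le_ext _ (pull (s ^+ 2)%g) idfun _ _ (@pullC R _) _ x2 Ak).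
have [theta [tS tA]] := SL2Z_presentation s4 a3 s2a.
by exists theta; rewrite tS tA.
Qed.

Variable theta : {multiplicative SL2Z -> Bir R}.
Hypothesis thetaS : bir_map (theta matS) = lift_map matS (Kconst 'i%C).
Hypothesis thetaA : bir_map (theta matA) = lift_map matA (Psub matA / Psub 1%g).
Implicit Types M N : SL2Z.

Definition cocycle M : K := (bir_map (theta M)).2 / Ky.

Let xc : nonconstant (Kx : K) := @Kx_nonconstant R.

Lemma cocycleE M c : bir_map (theta M) = lift_map M c -> cocycle M = c.
Proof.
move=> e; rewrite /cocycle e /lift_map /= mulrAC divff ?mul1r //; exact: Ky_neq0.
Qed.

Lemma theta_lift M :
  bir_map (theta M) = lift_map M (cocycle M) /\ exists k, degree_le k (cocycle M).
Proof.
suff [c [e ck]] : exists c, bir_map (theta M) = lift_map M c /\ exists k, degree_le k c.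
  by rewrite (cocycleE e).
have step N L c : bir_map (theta L) = lift_map L c -> (exists k, degree_le k c) ->
    (exists c', bir_map (theta N) = lift_map N c' /\ exists k, degree_le k c') ->
    exists c', bir_map (theta (N * L)%g) = lift_map (N * L)%g c' /\
      exists k, degree_le k c'.
  move=> Lc [k ck] [c' [Nc [k' c'k]]]; rewrite gmulfM.
  exists (c * pull (theta L) c'); split; first exact: lift_mul.
  exists (k + k')%N; apply: degree_leM ck _.
  exact: degree_le_moeb (@pullC R _) (pullX Lc) c'k.
elim/SL2Z_ind: M => [|M IH|M IH].
- exists 1; split; last by exists 0%N; exact: degree_le1.
  by rewrite multiplicative1 /lift_map moeb1 mulr1.
- by apply: step thetaS _ IH; exists 0%N; apply: degree_le_const; exact: i_neq0.
- by apply: step thetaA _ IH; exact: degree_le_coboundary.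
Qed.

Lemma theta_cocycle M : bir_map (theta M) = lift_map M (cocycle M).
Proof. by case: (theta_lift M). Qed.

Lemma pull_theta_Kx M : pull (theta M) Kx = moeb M Kx.
Proof. exact: pullX (theta_cocycle M). Qed.

Lemma cocycleM M N : cocycle (M * N)%g = cocycle N * pull (theta N) (cocycle M).
Proof.
by apply: cocycleE; rewrite gmulfM; apply: lift_mul; exact: theta_cocycle.
Qed.

Lemma cocycle_degreeM k l M N : degree_le k (cocycle M) -> degree_le l (cocycle N) ->
  degree_le (k + l) (cocycle (M * N)%g).
Proof.
move=> Mk Nl; rewrite cocycleM addnC; apply: degree_leM Nl _.
exact: degree_le_moeb (@pullC R _) (pull_theta_Kx N) Mk.
Qed.

Lemma cocycle_degreeX k M n : degree_le k (cocycle M) ->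
  degree_le (n * k) (cocycle (M ^+ n)%g).
Proof.
move=> Mk; elim: n => [|n IH].
  rewrite mul0n (_ : cocycle _ = 1); first exact: degree_le1.
  by apply: cocycleE; rewrite multiplicative1 /lift_map moeb1 mulr1.
by rewrite expgS mulSn; exact: cocycle_degreeM.
Qed.

Lemma pull_Psub M N : pull (theta N) (Psub M) = Psub (M * N)%g.
Proof. exact: pull_uni_subst (theta_cocycle N). Qed.

(** For A^2 S the two contributions of P at ASx cancel. *)
Lemma cocycle_letter b :
  cocycle (letter matS matA b) = Kconst 'i%C * (Psub (letter matS matA b) / Psub matS).
Proof.
have cA : cocycle matA = Psub matA / Psub 1%g by exact: cocycleE thetaA.
have cS : cocycle matS = Kconst 'i%C by exact: cocycleE thetaS.
have cAb : cocycle (if b then matA else matA ^+ 2)%g =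
    Psub (if b then matA else matA ^+ 2)%g / Psub 1%g.
  case: b => //; rewrite expg2 cocycleM cA fmorph_div !pull_Psub mul1g.
  by apply: coboundary_chain; exact: Psub_neq0.
by rewrite cocycleM cAb cS fmorph_div !pull_Psub mul1g.
Qed.

Section Zeros.
Variables (a : C) (a_free : no_isotropy (Some a)).
Hypothesis order_a : order_at a 1 (Psub 1%g).
Hypothesis order_orbit : forall h, ~ pm1 h -> order_at (moeb h a) 0 (Psub 1%g).
Implicit Types h : SL2Z.

(** P(Mx) has at ha the order of P at Mha, a point of the orbit other than a. *)
Lemma order_Psub M h : ~ pm1 (M * h)%g -> order_at (moeb h a) 0 (Psub M).
Proof.
move=> Mh; rewrite -[M]mul1g -pull_Psub.
apply: (order_at_moeb (@pullC R _) (pull_theta_Kx M)).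
  exact: orbit_denM.
by rewrite -orbitM //; exact: order_orbit.
Qed.

Lemma order_Psub1 M h : (M * h = 1)%g -> order_at (moeb h a) 1 (Psub M).
Proof.
move=> Mh; rewrite -[M]mul1g -pull_Psub.
apply: (order_at_moeb (@pullC R _) (pull_theta_Kx M)).
  exact: orbit_denM.
by rewrite -(orbitM a_free) Mh moeb1.
Qed.

Lemma order_letter h b k : order_at (moeb h a) k (Psub (letter matS matA b)) ->
  ~ pm1 (matS * h)%g -> order_at (moeb h a) k (cocycle (letter matS matA b)).
Proof.
move=> tk /order_Psub Sh; rewrite cocycle_letter.
have := order_atM (order_at_const (moeb h a) i_neq0) (order_atM tk (order_atV Sh)).
by rewrite oppr0 addr0 add0r.
Qed.

Lemma order_word_cons h b w k l : order_at (moeb h a) k (cocycle (wordSA w)) ->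
  order_at (moeb (wordSA w * h)%g a) l (cocycle (letter matS matA b)) ->
  order_at (moeb h a) (k + l) (cocycle (wordSA (b :: w))).
Proof.
move=> hk hl; rewrite [wordSA (b :: w)]/(letter matS matA b * wordSA w)%g cocycleM.
apply: order_atM hk _.
apply: (order_at_moeb (@pullC R _) (pull_theta_Kx _)); first exact: orbit_denM.
by rewrite -orbitM.
Qed.

(** At p = ha, the points t_l ... t_n p and S t_(l+1) ... t_n p met along the
    word v = t_1 ... t_n are images of a by inverses of nonempty words, or by S
    times such, never a itself. *)
Lemma order_word_before v u h : u <> [::] -> (wordSA v * h)%g = ((wordSA u)^-1)%g ->
  order_at (moeb h a) 0 (cocycle (wordSA v)).
Proof.
elim: v u => [|b v IH] u u0 vh.
  rewrite (_ : cocycle _ = Kconst 1); first exact: order_at_const (oner_neq0 _).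
  by apply: cocycleE; rewrite multiplicative1 /lift_map moeb1 rmorph1 mulr1.
have vh' : (wordSA v * h = (wordSA (rcons u b))^-1)%g.
  rewrite word_rcons invgM -vh /= -mulgA mulKg //.
rewrite -[0]addr0; apply: order_word_cons.
  by apply: IH vh'; case: (u).
rewrite vh'; apply: order_letter; last exact: matS_wordV_pm1.
apply: order_Psub; rewrite -vh' mulgA -[(_ * wordSA v)%g]/(wordSA (b :: v)) vh.
by move/pm1V/word_pm1.
Qed.

(** The letter b is the one whose factor P vanishes at ha, since it sends the
    current point to a.  The letters of v come before that, and those of u act
    on points T a and S T a with T a word, which differ from a. *)
Lemma order_word_at u b v h : (wordSA (b :: v) * h = 1)%g ->
  order_at (moeb h a) 1 (cocycle (wordSA (u ++ b :: v))).
Proof.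
move=> bvh; elim: u => [|b' u IH].
  have vh : (wordSA v * h = (wordSA [:: b])^-1)%g.
    by apply/esym/mulg1_eq; rewrite /= mulg1 mulgA.
  rewrite -[1]add0r; apply: order_word_cons.
    exact: order_word_before vh.
  rewrite vh; apply: order_letter; last exact: matS_wordV_pm1.
  by apply: order_Psub1; rewrite /= mulg1 mulgV.
rewrite cat_cons -[1]addr0; apply: order_word_cons IH _.
have -> : (wordSA (u ++ b :: v) * h = wordSA u)%g by rewrite word_cat -mulgA bvh mulg1.
apply: order_letter; last exact: matS_word_pm1.
by apply: order_Psub => /(@word_pm1 (b' :: u)).
Qed.

Fixpoint word_zeros w : seq C :=
  if w is _ :: v then moeb (wordSA w)^-1%g a :: word_zeros v else [::].

Lemma size_word_zeros w : size (word_zeros w) = size w.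
Proof. by elim: w => //= b w ->. Qed.

Lemma word_zerosP w z : z \in word_zeros w ->
  exists u b v, w = u ++ b :: v /\ z = moeb (wordSA (b :: v))^-1%g a.
Proof.
elim: w => // b w IH; rewrite inE => /orP[/eqP ->|/IH[u [b' [v [-> ->]]]]].
  by exists [::], b, w.
by exists (b :: u), b', v.
Qed.

Lemma uniq_word_zeros w : uniq (word_zeros w).
Proof.
elim: w => // b w IH.
change (uniq (moeb (wordSA (b :: w))^-1%g a :: word_zeros w)).
rewrite cons_uniq IH andbT; apply/negP => /word_zerosP.
case=> u [b' [v [wE /(orbit_inj a_free)]]]; rewrite invgK.
have -> : wordSA (b :: w) = (wordSA (b :: u) * wordSA (b' :: v))%g.
  by rewrite -word_cat cat_cons wE.
by rewrite invgM mulgA mulgV mul1g => /pm1V/(@word_pm1 (b :: u)).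
Qed.

(** c_w has the pairwise distinct zeros [word_zeros w]. *)
Lemma degree_word k w : degree_le k (cocycle (wordSA w)) -> (size w <= k)%N.
Proof.
case=> n [m [n0 m0 sn _ cE]].
have all_roots : all (root n) (word_zeros w).
  apply/allP => z /word_zerosP[u [b [v [wE ->]]]].
  apply: order_at_root _ m0 cE; rewrite wE.
  by apply: order_word_at; rewrite mulgV.
have := max_poly_roots n0 all_roots (uniq_word_zeros w).
by rewrite size_word_zeros => /leq_trans/(_ sn).
Qed.

(** If M acts trivially on x it fixes a, so M is 1 or -1; and the
    cocycle of S^2 is i^2 = -1. *)
Lemma theta_injective : injective theta.
Proof.
move=> M N MN; apply: divg1_eq; set L := (M / N)%g.
have L1 : theta L = 1%g.
  apply: (@mulIg _ (theta N)).
  by rewrite -gmulfM mul1g /L mulgVK.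
have := theta_cocycle L; rewrite L1 => -[/esym Lx /esym Ly].
have linE u v : poly_at Kx (linear_poly R u v) = u%:~R * Kx + v%:~R.
  exact: linear_poly_map.
have LX : linear_poly R (L 0 0) (L 0 1) = 'X * linear_poly R (L 1 0) (L 1 1).
  apply: (poly_at_inj xc); rewrite rmorphM /= poly_atX !linE.
  have cross (F : fieldType) (u v x : F) : v != 0 -> u / v = x -> u = x * v.
    by move=> v0 <-; rewrite divfK.
  exact: cross (moeb_den_neq0 _ xc) Lx.
have La : moeb L a = a.
  have := congr1 (fun p : {poly C} => p.[a]) LX; rewrite /= hornerM hornerX.
  have E u v : (linear_poly R u v).[a] = u%:~R * a + v%:~R.
    by have := linear_poly_map idfun u v a; rewrite map_poly_id // => ->.
  rewrite !E => e; rewrite /moeb e mulfK //; exact: (orbit_den_neq0 a_free L).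
have [//|LS2] := orbit_fix a_free La.
have cS : cocycle matS = Kconst 'i%C by exact: cocycleE thetaS.
have : cocycle L = Kconst (-1).
  by rewrite LS2 expg2 cocycleM cS pullC -rmorphM -expr2 sqr_i.
have -> : cocycle L = 1 by rewrite /cocycle L1 /= divff // Ky_neq0.
move/eqP; rewrite -(rmorph1 Kconst) (inj_eq (fmorph_inj _)) -addr_eq0.
by rewrite -(natrD _ 1 1) pnatr_eq0.
Qed.

(** Passing from M to the word w to which it is conjugate changes the degree of
    the cocycle of the n-th power by a constant at most, and the n-th power of w
    has n |w| letters. *)
Lemma theta_parabolic M : infinite_order (theta M) -> parabolic (theta M).
Proof.
move=> Minf; case: (SL2Z_torsion_or_word M) => [M12|[g [i [w [w0 ME]]]]].
  by case: (Minf 12%N) => //; rewrite -multiplicativeX M12 multiplicative1.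
have [_ [k Mk]] := theta_lift M.
have deg n : exists d, [/\ (d <= n * k + 2)%N, has_degree (theta M ^+ n)%g d &
    degree_le d (cocycle (M ^+ n)%g)].
  have nk := cocycle_degreeX n Mk; have nE := theta_cocycle (M ^+ n)%g.
  have [d dk hd] := degree_upper nE nk; exists d; rewrite -multiplicativeX addn2.
  by split=> //; exact: degree_lower nE nk hd.
have [u uP] := boolp.choice deg.
have [_ [kg gk]] := theta_lift g; have [_ [kg' g'k]] := theta_lift (g^-1)%g.
have Z0 j : degree_le 0 (cocycle (matS ^+ j)%g).
  rewrite -(muln0 j); apply: cocycle_degreeX.
  by rewrite (cocycleE thetaS); apply: degree_le_const; exact: i_neq0.
have wordX n : wordSA (flatten (nseq n w)) =
    (matS ^+ (2 * (i * n)) * (g * (M ^+ n * g^-1)))%g.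
  have cZ N j : commute (matS ^+ 2 ^+ j)%g N.
    exact/commute_sym/commuteX/commute_sym/matS2C.
  have -> : (g * (M ^+ n * g^-1) = (matS ^+ 2 ^+ i * wordSA w) ^+ n)%g.
    rewrite ME -conjXg conjgE; set X := (_ ^+ n)%g.
    by rewrite -(mulgA g^-1)%g (mulgK g) mulVKg.
  rewrite word_nseq (expgMn _ (cZ _ _)) mulgA !expgnA -!(expgnA (matS ^+ 2)%g).
  rewrite -expgnDr addnn -mul2n expgnA -(expgnA matS 2 2) matS4.
  by rewrite expg1n mul1g.
have low n : (n <= u n + (kg + kg'))%N.
  have [_ _ un] := uP n.
  have := cocycle_degreeM (Z0 (2 * (i * n))%N)
    (cocycle_degreeM gk (cocycle_degreeM un g'k)).
  rewrite -wordX => /degree_word; rewrite size_flatten /shape map_nseq sumn_nseq.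
  have : (0 < size w)%N by case: (w) w0.
  nia.
exists u; first by move=> n; case: (uP n).
(* With D = kg + kg', the bound n <= u n + D gives n <= 2 u n once n >= 2 D, and
   n k + 2 <= (k + 2) n once n >= 1. *)
left; exists 2%N, (k + 2)%N, (2 * (kg + kg') + 1)%N => n n0.
rewrite expn1; have := low n; have [uk _ _] := uP n.
split; nia.
Qed.

End Zeros.
End Cocycle.

(** * The theorem *)

Lemma is_thetaP (R : realType) (P : {fraction {poly R[i]}})
    (theta : {multiplicative SL2Z -> Bir R}) :
  is_theta P theta <->
  bir_map (theta matS) = lift_map matS (Kconst 'i%C) /\
  bir_map (theta matA) = lift_map matA
    (uni_subst P (moeb matA Kx) / uni_subst P (moeb 1%g Kx)).
Proof.
have Sx (F : fieldType) (x : F) : moeb matS x = - x^-1.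
  by rewrite /moeb /moeb_den !matSE /= mul0r add0r mulN1r addr0 div1r invrN.
have Ax (F : fieldType) (x : F) : moeb matA x = (x - 1) / x.
  rewrite /moeb /moeb_den !matAE /= addr0 !mulN1r invrN mulrN -mulNr.
  by rewrite opprD opprK.
by rewrite /is_theta mulRS /lift_map Sx Ax moeb1 (mulrC Ky (Kconst _)).
Qed.

Lemma is_theta_unique (R : realType) (P : {fraction {poly R[i]}})
    (theta theta' : {multiplicative SL2Z -> Bir R}) :
  is_theta P theta -> is_theta P theta' -> theta' =1 theta.
Proof.
move=> [tS tA] [tS' tA'].
have S_eq : theta' matS = theta matS by apply: bir_map_inj; rewrite tS tS'.
have A_eq : theta' matA = theta matA.
  by apply: bir_map_inj; rewrite -mulRS tA tA'.
elim/SL2Z_ind => [|M IH|M IH]; first by rewrite !multiplicative1.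
  by rewrite !gmulfM IH S_eq.
by rewrite !gmulfM IH A_eq.
Qed.

Unset Implicit Arguments.

Theorem proposition3p8 (R : realType) (P : {fraction {poly R[i]}}) (m : nat)
    (zs ps : seq R[i]) :
  (0 < m)%N ->
  uniq zs -> size zs = m ->
  uniq ps -> size ps = m ->
  (forall a : R[i], is_zero P a <-> a \in zs) ->
  (forall a : R[i], is_pole P a <-> a \in ps) ->
  (forall a : R[i], a \in zs -> is_simple_zero P a) ->
  (forall a : R[i], a \in ps -> is_simple_pole P a) ->
  (forall a b : R[i], a \in zs ++ ps -> b \in zs ++ ps -> a != b ->
     ~ same_orbit (Some a) (Some b)) ->
  (forall a : R[i], a \in zs ++ ps -> no_isotropy (Some a)) ->
  exists theta : {multiplicative SL2Z -> Bir R},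
    [/\ is_theta P theta,
        (forall theta' : {multiplicative SL2Z -> Bir R},
           is_theta P theta' -> theta' =1 theta) &
        parabolic_embedding theta].
Proof.
move=> m0 _ zs_m _ _ zsP psP zs1 _ orbits free.
have [a az] : exists a, a \in zs.
  by case: zs zs_m {zsP zs1 orbits free} m0 => [<- //|a l _ _]; exists a; rewrite mem_head.
have azp : a \in zs ++ ps by rewrite mem_cat az.
have a_free := free a azp; have Pa := zs1 a az.
have P0 : P != 0.
  have [n [d [n0 d0 ->]]] := Pa.
  rewrite !mulf_neq0 ?invr_eq0 ?expr1z ?tofrac_eq0 ?polyXsubC_eq0 //.
    exact: horner_neq0 n0.
  exact: horner_neq0 d0.
have order_a : order_at a 1 (uni_subst P (moeb 1%g Kx)).
  by rewrite moeb1; exact: has_order_at.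
have order_orbit h : ~ pm1 h ->
    order_at (moeb h a) 0 (uni_subst P (moeb 1%g Kx)).
  move=> h1; have [k hk] := has_order_exists (moeb h a) P0.
  have ha : a != moeb h a.
    by apply/eqP => e; apply: h1; apply: (orbit_fix a_free); rewrite -e.
  have orb : same_orbit (Some a) (Some (moeb h a)).
    by exists h; exact: mobius_orbit.
  (* Otherwise ha would be a second zero or pole of P in the orbit of a. *)
  suff k0 : k = 0 by rewrite moeb1 -k0; exact: has_order_at.
  have [k0|k0|//] := ltgtP k 0; exfalso.
    have : moeb h a \in ps by apply/psP; exists k.
    by move=> hp; apply: (orbits a (moeb h a) azp _ ha orb); rewrite mem_cat hp orbT.
  have : moeb h a \in zs by apply/zsP; exists k.
  by move=> hp; apply: (orbits a (moeb h a) azp _ ha orb); rewrite mem_cat hp.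
have [theta [tS tA]] := exists_theta P0.
have thetaP : is_theta P theta by apply/is_thetaP.
exists theta; split=> //; first by move=> theta'; exact: is_theta_unique thetaP.
split; first exact: theta_injective P0 theta tS tA a a_free.
exact: theta_parabolic P0 theta tS tA a a_free order_a order_orbit.
Qed.
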